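(* One can compute in polynomial time a $4$-approximation for instances of the private $k$-center problem with outliers, and a $5$-approximation for instances of the private $k$-supplier problem with outliers.
   Context: Let $(X,d)$ be a finite metric space, $P\subseteq X$ the set of points and $L\subseteq X$ the set of possible center locations. An instance consists of $P$, $L$, an integer $k\in\mathbb{N}$, a lower bound $\ell\in\mathbb{N}$, and a number $o$. A feasible solution is a set of centers $C\subseteq L$ with $|C|\le k$, a set of outliers $O\subseteq P$ with $|O|\le o$, and an assignment $\phi:P\setminus O\to C$ such that $|\phi^{-1}(c)|\ge \ell$ for every $c\in C$. The objective is to minimize $\max_{x\in P\setminus O} d(x,\phi(x))$. The problem is called private $k$-supplier with outliers for arbitrary $P$ and $L$, and private $k$-center with outliers when $P=L$. An $\alpha$-approximation is a feasible solution whose objective value is at most $\alpha$ times the optimal value (for instances that have a feasible solution). *)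

(* Defs.v *)
From HB Require Import structures.
From mathcomp Require Import all_boot all_order all_algebra.

Set Implicit Arguments.
Unset Strict Implicit.
Unset Printing Implicit Defensive.

Import Order.TTheory GRing.Theory Num.Theory.

(** * Random access machines with logarithmic cost

   The machine has registers, addressed by constants, and a memory, addressed
   by computed values; both hold natural numbers of unbounded size. Programs
   are structured (loops instead of jumps). Every value computed, addresses
   included, is charged its binary length, so that time on this machine and
   time on a Turing machine are polynomially related although multiplication
   and division are primitive. *)

Inductive binop := Add | Sub | Mul | Div.

Inductive expr :=
  | Const of nat
  | Reg of nat
  | Mem of expr
  | Bin of binop & expr & expr.

(* In [If] and [While], a nonzero value means true. *)
Inductive cmd :=
  | Skip
  | SetReg of nat & expr
  | SetMem of expr & expr
  | Seq of cmd & cmd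
  | If of expr & cmd & cmd
  | While of expr & cmd.

Record state := State { regs : nat -> nat; mem : nat -> nat }.

Definition update (f : nat -> nat) (a v : nat) : nat -> nat :=
  fun b => if b == a then v else f b.

(* [Sub] is truncated, and division by 0 yields 0. *)
Definition eval_binop (op : binop) (a b : nat) : nat :=
  match op with
  | Add => a + b
  | Sub => a - b
  | Mul => a * b
  | Div => a %/ b
  end.

Fixpoint eval (s : state) (e : expr) : nat :=
  match e with
  | Const a => a
  | Reg i => regs s i
  | Mem e1 => mem s (eval s e1)
  | Bin op e1 e2 => eval_binop op (eval s e1) (eval s e2)
  end.

(* Number of binary digits, with [bitlen 0 = 1]. *)
Definition bitlen (a : nat) : nat := (trunc_log 2 a).+1.

(* The sum of the binary lengths of the values of all subexpressions. *)
Fixpoint eval_time (s : state) (e : expr) : nat :=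
  bitlen (eval s e) +
  match e with
  | Const _ | Reg _ => 0
  | Mem e1 => eval_time s e1
  | Bin _ e1 e2 => eval_time s e1 + eval_time s e2
  end.

(* [exec c s t s']: started in [s], the program [c] halts in [s'] after time
   [t]. *)
Inductive exec : cmd -> state -> nat -> state -> Prop :=
  | exec_Skip s :
      exec Skip s 1 s
  | exec_SetReg s i e :
      exec (SetReg i e) s (eval_time s e).+1
        (State (update (regs s) i (eval s e)) (mem s))
  | exec_SetMem s e1 e2 :
      exec (SetMem e1 e2) s (eval_time s e1 + eval_time s e2).+1
        (State (regs s) (update (mem s) (eval s e1) (eval s e2)))
  | exec_Seq s c1 t1 s1 c2 t2 s2 :
      exec c1 s t1 s1 -> exec c2 s1 t2 s2 ->
      exec (Seq c1 c2) s (t1 + t2) s2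
  | exec_IfTrue s e c1 c2 t s' :
      eval s e <> 0 -> exec c1 s t s' ->
      exec (If e c1 c2) s (eval_time s e + t).+1 s'
  | exec_IfFalse s e c1 c2 t s' :
      eval s e = 0 -> exec c2 s t s' ->
      exec (If e c1 c2) s (eval_time s e + t).+1 s'
  | exec_WhileFalse s e c :
      eval s e = 0 ->
      exec (While e c) s (eval_time s e).+1 s
  | exec_WhileTrue s e c t1 s1 t2 s2 :
      eval s e <> 0 -> exec c s t1 s1 -> exec (While e c) s1 t2 s2 ->
      exec (While e c) s (eval_time s e + t1 + t2).+1 s2.

(* Input and output words are stored in memory from address 0 on, with their
   length in register 0; all other cells are initially 0. *)
Definition init_state (w : seq nat) : state :=
  State (update (fun=> 0) 0 (size w)) (nth 0 w).

Definition output (s : state) : seq nat := mkseq (mem s) (regs s 0).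

Definition input_size (w : seq nat) : nat := \sum_(a <- w) bitlen a.

(* For the search problem with set of instances [dom], instance encoding [enc]
   and relation [sol] between instances and acceptable output words. *)
Definition poly_time_solvable (A : Type) (dom : A -> Prop) (enc : A -> seq nat)
    (sol : A -> seq nat -> Prop) : Prop :=
  exists (c : cmd) (p : {poly nat}), forall a : A, dom a ->
    exists (t : nat) (s : state),
      [/\ exec c (init_state (enc a)) t s,
          t <= p.[input_size (enc a)]%R
        & sol a (output s)].

(** * Private clustering with outliers *)

Local Open Scope ring_scope.

Definition is_metric (X : Type) (d : X -> X -> rat) : Prop :=
  [/\ forall x y, 0 <= d x y,
      forall x y, d x y = 0 <-> x = y,
      forall x y, d x y = d y x
    & forall x y z, d x z <= d x y + d y z].

(* Distances are rational so that an instance has a finite description. *)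
Record instance := Instance {
  space : finType;
  dist : space -> space -> rat;
  dist_metric : is_metric dist;
  points : {set space};
  locations : {set space};
  max_centers : nat;
  lower_bound : nat;
  max_outliers : nat }.

(* Only the values of [assignment] at the points that are not outliers
   matter. *)
Record solution (X : finType) := Solution {
  centers : {set X};
  outliers : {set X};
  assignment : {ffun X -> X} }.

Definition served (I : instance) (S : solution (space I)) : {set space I} :=
  points I :\: outliers S.

Definition feasible (I : instance) (S : solution (space I)) : Prop :=
  [/\ centers S \subset locations I,
      (#|centers S| <= max_centers I)%N,
      outliers S \subset points I,
      (#|outliers S| <= max_outliers I)%N
    & {in served S, forall x, assignment S x \in centers S} /\
      {in centers S, forall c,
        (lower_bound I <= #|[set x in served S | assignment S x == c]|)%N}].

(* The maximum is 0 if all points are outliers. *)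
Definition objective (I : instance) (S : solution (space I)) : rat :=
  \big[Num.max/0]_(x in served S) dist x (assignment S x).

Definition is_optimal_value (I : instance) (v : rat) : Prop :=
  (exists2 S : solution (space I), feasible S & objective S = v) /\
  (forall S : solution (space I), feasible S -> v <= objective S).

Definition is_approximation (alpha : rat) (I : instance)
    (S : solution (space I)) : Prop :=
  feasible S /\
  (forall v, is_optimal_value I v -> objective S <= alpha * v).

(** Encodings; the elements of the space are numbered in the order of
   [enum]. *)

Definition encode_set (X : finType) (A : {set X}) : seq nat :=
  [seq nat_of_bool (x \in A) | x <- enum X].

(* Distances are nonnegative, so the absolute value loses no information. *)
Definition encode_instance (I : instance) : seq nat :=
  [:: #|space I|; max_centers I; lower_bound I; max_outliers I]
  ++ encode_set (points I) ++ encode_set (locations I)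
  ++ [seq `|numq (dist x y)|%N | x <- enum (space I), y <- enum (space I)]
  ++ [seq `|denq (dist x y)|%N | x <- enum (space I), y <- enum (space I)].

Definition encode_solution (X : finType) (S : solution X) : seq nat :=
  encode_set (centers S) ++ encode_set (outliers S)
  ++ [seq nat_of_ord (enum_rank (assignment S x)) | x <- enum X].

(* On an instance of the problem without feasible solution, the program must
   still halt within the time bound, but its output is unconstrained. *)
Definition poly_time_approximable (problem : instance -> Prop) (alpha : rat) :
    Prop :=
  poly_time_solvable problem encode_instance
    (fun (I : instance) (w : seq nat) =>
      (exists S : solution (space I), feasible S) ->
      exists2 S : solution (space I),
        is_approximation alpha S & w = encode_solution S).

Definition private_k_supplier_with_outliers (I : instance) : Prop := True.

Definition private_k_center_with_outliers (I : instance) : Prop :=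
  points I = locations I.

(* Main.v *)
(* Let [R] be the optimal value, guessed among the pairwise distances. For a
   point [v], let [G v] and [E v] be the sets of points within [2 * R] and
   [4 * R] of [v]. The greedy algorithm repeatedly picks, among the uncovered
   points [v] with a location within [R] and with at least [lower_bound] points
   in [G v], one with as many uncovered points in [G v] as possible, and covers
   [E v]. Since [v] lies outside the earlier sets [E], the sets [G] of the picked
   points are disjoint; assigning [G v] to the center of [v] respects the lower
   bound. An optimal cluster has diameter at most [2 * R], so it lies in [E v] as
   soon as it meets [G v], and it lies in [G v] for each of its own points [v];
   charging optimal clusters to picks as in the 3-approximation of Charikar et
   al. for k-center with outliers shows that enough points are covered. The
   center of [v] is [v] itself if possible, which yields the factor 4, and
   otherwise a location within [R], which yields the factor 5.

   The algorithm is written with loops bounded by the number [n] of elements of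
   the space, and with assignments that can increase the largest stored value by
   at most a constant; every such program runs in polynomial time. *)

Require Import Defs.
From HB Require Import structures.
From mathcomp Require Import all_boot all_order all_algebra.
From mathcomp Require Import zify ring lra.
(* Again, so that [mem] is the memory of a state. *)
Import Defs.

Set Implicit Arguments.
Unset Strict Implicit.
Unset Printing Implicit Defensive.

Import Order.TTheory GRing.Theory Num.Theory.

(** * Bounded-loop programs *)

Definition set_reg (i v : nat) (s : state) : state :=
  State (update (regs s) i v) (mem s).

Definition set_mem (a v : nat) (s : state) : state :=
  State (regs s) (update (mem s) a v).

(* [LFor i c] runs [c] with register [i] ranging over [0 .. n - 1], where [n]
   is the value of register 1, which programs never assign. *)
Inductive lcmd :=
  | LSkip
  | LReg of nat & expr
  | LMem of expr & expr
  | LSeq of lcmd & lcmd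
  | LIf of expr & lcmd & lcmd
  | LFor of nat & lcmd.

(** Subtraction being truncated, the loop test is nonzero exactly while register [i] is below
    register 1. *)
Fixpoint compile (c : lcmd) : cmd :=
  match c with
  | LSkip => Skip
  | LReg i e => SetReg i e
  | LMem e1 e2 => SetMem e1 e2
  | LSeq c1 c2 => Seq (compile c1) (compile c2)
  | LIf e c1 c2 => If e (compile c1) (compile c2)
  | LFor i c1 =>
      Seq (SetReg i (Const 0))
        (While (Bin Sub (Reg 1) (Reg i))
           (Seq (compile c1) (SetReg i (Bin Add (Reg i) (Const 1)))))
  end.

(** A total semantics: the number of passes is read once, before the loop. It agrees with [compile]
    on programs satisfying [wf], as [exec_run] shows. *)
Fixpoint run (c : lcmd) (s : state) : state :=
  match c with
  | LSkip => s
  | LReg i e => set_reg i (eval s e) s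
  | LMem e1 e2 => set_mem (eval s e1) (eval s e2) s
  | LSeq c1 c2 => run c2 (run c1 s)
  | LIf e c1 c2 => if eval s e == 0 then run c2 s else run c1 s
  | LFor i c1 =>
      iter (regs s 1)
        (fun s' => let s1 := run c1 s' in set_reg i (regs s1 i + 1) s1)
        (set_reg i 0 s)
  end.

Fixpoint writes (r : nat) (c : lcmd) : bool :=
  match c with
  | LSkip | LMem _ _ => false
  | LReg i _ => r == i
  | LSeq c1 c2 | LIf _ c1 c2 => writes r c1 || writes r c2
  | LFor i c1 => (r == i) || writes r c1
  end.

Fixpoint writes_mem (c : lcmd) : bool :=
  match c with
  | LSkip | LReg _ _ => false
  | LMem _ _ => true
  | LSeq c1 c2 | LIf _ c1 c2 => writes_mem c1 || writes_mem c2
  | LFor _ c1 => writes_mem c1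
  end.

(** The threshold matches the hypothesis [16 <= V] of the value bounds below, which makes every
    constant at most [V]. *)
Fixpoint small_consts (e : expr) : bool :=
  match e with
  | Const a => a <= 16
  | Reg _ => true
  | Mem e1 => small_consts e1
  | Bin _ e1 e2 => small_consts e1 && small_consts e2
  end.

(* The expressions that may be assigned: their value exceeds the largest value
   in the state by at most 3, so that values grow only linearly in time. *)
Definition additive (e : expr) : bool :=
  match e with
  | Const a => a <= 3
  | Reg _ | Mem _ | Bin Sub (Reg _) _ => true
  | Bin Add (Reg _) (Const a) => a <= 3
  | _ => false
  end.

(** Sparing register 1 fixes the loop bound, and sparing the counter in the body makes each loop
    stop after exactly [n] passes. *)
Fixpoint wf (c : lcmd) : bool :=
  match c with
  | LSkip => true
  | LReg i e => [&& i != 1, small_consts e & additive e]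
  | LMem e1 e2 => [&& small_consts e1, small_consts e2 & additive e2]
  | LSeq c1 c2 => wf c1 && wf c2
  | LIf e c1 c2 => [&& small_consts e, wf c1 & wf c2]
  | LFor i c1 => [&& i != 1, ~~ writes i c1 & wf c1]
  end.

Lemma run_reg_frame r c s : ~~ writes r c -> regs (run c s) r = regs s r.
Proof.
elim: c s => [|i e|e1 e2|c1 IH1 c2 IH2|e c1 IH1 c2 IH2|i c IH] s //=.
- by rewrite /update => /negPf ->.
- by rewrite negb_or => /andP[H1 H2]; rewrite IH2 ?IH1.
- by rewrite negb_or => /andP[H1 H2]; case: ifP => _; rewrite ?IH2 ?IH1.
- rewrite negb_or => /andP[/negPf ri H].
  elim: (regs s 1) => [|k IHk] /=; first by rewrite /update ri.
  by rewrite /update ri IH.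
Qed.

Lemma run_mem_frame c s : ~~ writes_mem c -> mem (run c s) = mem s.
Proof.
elim: c s => [|i e|e1 e2|c1 IH1 c2 IH2|e c1 IH1 c2 IH2|i c IH] s //=.
- by rewrite negb_or => /andP[H1 H2]; rewrite IH2 ?IH1.
- by rewrite negb_or => /andP[H1 H2]; case: ifP => _; rewrite ?IH2 ?IH1.
- by move=> H; elim: (regs s 1) => [|k IHk] //=; rewrite IH.
Qed.

Lemma wf_reg1 c s : wf c -> regs (run c s) 1 = regs s 1.
Proof.
move=> wc; apply: run_reg_frame; elim: c wc => //=.
- by move=> i e /and3P[]; rewrite eq_sym.
- by move=> c1 IH1 c2 IH2 /andP[/IH1 h1 /IH2 h2]; rewrite negb_or h1.
- by move=> e c1 IH1 c2 IH2 /and3P[_ /IH1 h1 /IH2 h2]; rewrite negb_or h1.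
- by move=> i c IH /and3P[h _ /IH hc]; rewrite negb_or eq_sym h.
Qed.

(** The loop rule: [I j] holds before pass [j]. The frame lemmas supply the values of the counter
    and of register 1, so [I] need not mention them. *)
Lemma run_for_ind (I : nat -> state -> Prop) i c s :
  wf (LFor i c) ->
  I 0 (set_reg i 0 s) ->
  (forall j s', j < regs s 1 -> regs s' 1 = regs s 1 -> regs s' i = j ->
     I j s' -> I j.+1 (set_reg i j.+1 (run c s'))) ->
  I (regs s 1) (run (LFor i c) s).
Proof.
move=> /= /and3P[i1 ic wc] I0 IS.
set f := fun s' : state => _.
suff H k : k <= regs s 1 ->
    [/\ regs (iter k f (set_reg i 0 s)) 1 = regs s 1,
        regs (iter k f (set_reg i 0 s)) i = k & I k (iter k f (set_reg i 0 s))].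
  by have [] := H (regs s 1) (leqnn _).
elim: k => [_|k IHk kn].
  by split=> //=; rewrite /update ?eqxx // eq_sym (negPf i1).
have [h1 hi hI] := IHk (ltnW kn).
rewrite iterS; set s' := iter _ _ _ in h1 hi hI *.
have -> : f s' = set_reg i k.+1 (run c s').
  by rewrite /f run_reg_frame // hi addn1.
split; last exact: IS.
- by rewrite /= /update eq_sym (negPf i1) wf_reg1.
- by rewrite /= /update eqxx.
Qed.

(** * Running time of bounded-loop programs *)

Fixpoint expr_size (e : expr) : nat :=
  match e with
  | Const _ | Reg _ => 1
  | Mem e1 => (expr_size e1).+1
  | Bin _ e1 e2 => (expr_size e1 + expr_size e2).+1
  end.

Definition bounded (V : nat) (s : state) : Prop :=
  (forall i, regs s i <= V) /\ (forall a, mem s a <= V).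

Lemma bounded_le V V' s : V <= V' -> bounded V s -> bounded V' s.
Proof. by move=> h [H1 H2]; split=> i; apply: leq_trans h. Qed.

Lemma bounded_set_reg V s i v :
  bounded V s -> v <= V -> bounded V (set_reg i v s).
Proof. by move=> [H1 H2] hv; split=> // r /=; rewrite /update; case: ifP. Qed.

Lemma bounded_set_mem V s a v :
  bounded V s -> v <= V -> bounded V (set_mem a v s).
Proof. by move=> [H1 H2] hv; split=> // r /=; rewrite /update; case: ifP. Qed.

Lemma expr_size_gt0 e : 0 < expr_size e.
Proof. by case: e. Qed.

(** Every node costs at most one factor [V], and products add exponents; for sums this uses
    [2 <= V]. *)
Lemma eval_le V s e : 16 <= V -> bounded V s -> small_consts e ->
  eval s e <= V ^ expr_size e.
Proof.
move=> V16 [H1 H2]; have V0 : 0 < V by lia.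
elim: e => [a|i|e IH|op e1 IH1 e2 IH2] /=.
- by move=> h; rewrite expn1; lia.
- by rewrite expn1.
- by move=> _; rewrite expnS; apply: leq_trans (H2 _) _; rewrite leq_pmulr ?expn_gt0 ?V0.
case/andP => /IH1 {}IH1 /IH2 {}IH2; rewrite expnS expnD.
have P1 : 0 < V ^ expr_size e1 by rewrite expn_gt0 V0.
have P2 : 0 < V ^ expr_size e2 by rewrite expn_gt0 V0.
have PP : V ^ expr_size e1 * V ^ expr_size e2 * 2 <=
          V * (V ^ expr_size e1 * V ^ expr_size e2).
  by rewrite mulnC leq_mul2r; apply/orP; right; lia.
apply: leq_trans PP.
case: op => /=; first nia; first nia; first nia.
apply: leq_trans (leq_div _ _) _; nia.
Qed.

Lemma bitlen_le_exp a V m w :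
  0 < m -> a <= V ^ m -> bitlen V <= w -> bitlen a <= m * w.
Proof.
move=> m0 aV Vw.
have wp : 0 < w by apply: leq_trans Vw.
have VL : V < 2 ^ w.
  by apply: (leq_trans (trunc_log_ltn V (isT : 1 < 2))); rewrite leq_exp2l.
case: (posnP a) => [->|a0]; first by rewrite /bitlen /= muln_gt0 m0.
rewrite /bitlen -(ltn_exp2l _ _ (isT : 1 < 2)).
apply: (leq_ltn_trans (trunc_logP (isT : 1 < 2) a0)); apply: (leq_ltn_trans aV).
by rewrite mulnC expnM ltn_exp2r.
Qed.

(** There are [expr_size e] subexpressions, each with a value of length at most [expr_size e * w];
    hence the square. *)
Lemma eval_time_le V s e w :
  16 <= V -> bounded V s -> small_consts e -> bitlen V <= w ->
  eval_time s e <= expr_size e ^ 2 * w.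
Proof.
move=> V16 bV se Vw.
have B e' : small_consts e' -> bitlen (eval s e') <= expr_size e' * w.
  move=> se'; apply: bitlen_le_exp (expr_size_gt0 _) _ Vw.
  exact: eval_le.
elim: e se => [a|i|e IH|op e1 IH1 e2 IH2] se.
- by have := B _ se; rewrite /= addn0.
- by have := B _ se; rewrite /= addn0.
- have := B _ se; have := IH se; rewrite /=; nia.
- have := B _ se; case/andP: (se) => /IH1 {}IH1 /IH2 {}IH2; rewrite /=; nia.
Qed.

Lemma additive_le V s e : 16 <= V -> bounded V s -> additive e ->
  eval s e <= V + 3.
Proof.
move=> V16 [H1 H2]; case: e => [a|i|e|[] [a|i|e|op e1 e2] e'] //=.
- by lia.
- by move=> _; apply: leq_trans (H1 _) _; lia.
- by move=> _; apply: leq_trans (H2 _) _; lia.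
- by case: e' => //= a h; rewrite leq_add.
- by move=> _; have := H1 i; lia.
Qed.

(** The constant 3 comes from [additive], and the 1 added per pass pays for the counter.
    Conditionals use a sum in place of a maximum, which keeps the bound polynomial in [N]. *)
Fixpoint growth (c : lcmd) (N : nat) : nat :=
  match c with
  | LSkip => 0
  | LReg _ _ | LMem _ _ => 3
  | LSeq c1 c2 | LIf _ c1 c2 => growth c1 N + growth c2 N
  | LFor _ c1 => N * (growth c1 N + 1)
  end.

Lemma run_bounded c s N V : wf c -> regs s 1 <= N -> 16 <= V ->
  bounded V s -> bounded (V + growth c N) (run c s).
Proof.
elim: c s V => [|i e|e1 e2|c1 IH1 c2 IH2|e c1 IH1 c2 IH2|i c IH] s V /=.
- by rewrite addn0.
- move=> /and3P[_ se fe] _ V16 bV; apply: bounded_set_reg; last exact: additive_le.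
  by apply: bounded_le bV; rewrite leq_addr.
- move=> /and3P[_ se fe] _ V16 bV; apply: bounded_set_mem; last exact: additive_le.
  by apply: bounded_le bV; rewrite leq_addr.
- move=> /andP[w1 w2] sN V16 bV; rewrite addnA; apply: IH2 => //.
  + by rewrite wf_reg1.
  + by lia.
  + exact: IH1.
- move=> /and3P[_ w1 w2] sN V16 bV; case: ifP => _.
  + apply: bounded_le (IH2 _ _ w2 sN V16 bV); lia.
  + apply: bounded_le (IH1 _ _ w1 sN V16 bV); lia.
- move=> /and3P[i1 ic wc] sN V16 bV.
  apply: (@bounded_le (V + regs s 1 * (growth c N + 1))).
    by rewrite leq_add2l leq_mul2r sN orbT.
  apply: (run_for_ind (I := fun j s' => bounded (V + j * (growth c N + 1)) s')).
  + by rewrite /= i1 ic.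
  + by apply: bounded_set_reg; rewrite addn0.
  + move=> j s' jn s'1 s'i bj.
    (* The new counter is expressed as a stored value plus 1, so that the bound on the state after
       the body applies to it. *)
    have -> : j.+1 = regs (run c s') i + 1 by rewrite run_reg_frame // s'i addn1.
    have -> : V + (regs (run c s') i + 1) * (growth c N + 1) =
      V + j * (growth c N + 1) + growth c N + 1.
      by rewrite run_reg_frame // s'i; ring.
    have B : bounded (V + j * (growth c N + 1) + growth c N) (run c s').
      by apply: IH => //; rewrite ?s'1 //; lia.
    apply: bounded_set_reg; last by rewrite leq_add2r; case: B.
    by apply: bounded_le B; rewrite leq_addr.
Qed.

(** The loop test and the increment both have size 3 and cost [9 * w] each. A pass thus adds
    [18 * w + 2]; the initialization and the last test add [10 * w + 2]. *)
Fixpoint time_bound (c : lcmd) (N w : nat) : nat :=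
  match c with
  | LSkip => 1
  | LReg _ e => expr_size e ^ 2 * w + 1
  | LMem e1 e2 => expr_size e1 ^ 2 * w + expr_size e2 ^ 2 * w + 1
  | LSeq c1 c2 => time_bound c1 N w + time_bound c2 N w
  | LIf e c1 c2 =>
      expr_size e ^ 2 * w + time_bound c1 N w + time_bound c2 N w + 1
  | LFor _ c1 => N * (time_bound c1 N w + 18 * w + 2) + 10 * w + 2
  end.

(** Two bounds are kept: [V] for the current state, which grows along the induction, and [V'] for
    all states to come, which fixes the word length [w]. *)
Lemma exec_run c s N V V' w : wf c -> regs s 1 <= N -> 16 <= V ->
  bounded V s -> V + growth c N <= V' -> bitlen V' <= w ->
  exists2 t, exec (compile c) s t (run c s) & t <= time_bound c N w.
Proof.
move=> wc sN V16 bV VV' w'.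
have TE s' e : small_consts e -> bounded V' s' ->
    eval_time s' e <= expr_size e ^ 2 * w.
  by move=> se bs; apply: eval_time_le w' => //; lia.
elim: c s V wc sN V16 bV VV' =>
  [|i e|e1 e2|c1 IH1 c2 IH2|e c1 IH1 c2 IH2|i c IH] s V /= wc sN V16 bV VV'.
- by exists 1 => //; apply: exec_Skip.
- exists (eval_time s e).+1; first exact: exec_SetReg.
  case/and3P: wc => _ se _; rewrite addn1 ltnS; apply: TE => //.
  by apply: bounded_le bV; lia.
- exists (eval_time s e1 + eval_time s e2).+1; first exact: exec_SetMem.
  have bV' : bounded V' s by apply: bounded_le bV; lia.
  by case/and3P: wc => se1 se2 _; rewrite addn1 ltnS leq_add ?TE.
- case/andP: wc => w1 w2.
  have [|||||t1 E1 T1] := IH1 s V => //; first by lia.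
  have [|||||t2 E2 T2] := IH2 (run c1 s) (V + growth c1 N) => //.
  + by rewrite wf_reg1.
  + by lia.
  + exact: run_bounded.
  + by lia.
  by exists (t1 + t2); [apply: exec_Seq E1 E2 | rewrite leq_add].
- case/and3P: wc => se w1 w2.
  have bV' : bounded V' s by apply: bounded_le bV; lia.
  have := TE _ _ se bV' => T.
  case: (eqVneq (eval s e) 0) => h.
  + have [|||||t2 E2 T2] := IH2 s V => //; first by lia.
    by exists (eval_time s e + t2).+1; [apply: exec_IfFalse | lia].
  + have [|||||t2 E2 T2] := IH1 s V => //; first by lia.
    by exists (eval_time s e + t2).+1; [apply: exec_IfTrue => //; apply/eqP | lia].
case/and3P: wc => i1 ic wc.
set f := fun s' : state => _; set n := regs s 1 in sN *.
(* Induction on the number [k] of remaining passes, with a bound [Vk] on the current values that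
   leaves room for the growth still to come. *)
have W s' k Vk : k <= n -> regs s' 1 = n -> regs s' i = n - k -> 16 <= Vk ->
    bounded Vk s' -> Vk + k * (growth c N + 1) <= V' ->
  exists2 t, exec (While (Bin Sub (Reg 1) (Reg i))
           (Seq (compile c) (SetReg i (Bin Add (Reg i) (Const 1)))))
             s' t (iter k f s')
    & t <= k * (time_bound c N w + 18 * w + 2) + (9 * w + 1).
  elim: k s' Vk => [|k IHk] s' Vk kn s'1 s'i Vk16 bk kV.
    exists (eval_time s' (Bin Sub (Reg 1) (Reg i))).+1.
      by apply: exec_WhileFalse; rewrite /= s'1 s'i; lia.
    have := TE s' (Bin Sub (Reg 1) (Reg i)) isT => /(_ (bounded_le _ bk)).
    by rewrite /=; lia.
  have T1 := TE s' (Bin Sub (Reg 1) (Reg i)) isT (bounded_le _ bk).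
  have {}T1 : eval_time s' (Bin Sub (Reg 1) (Reg i)) <= 9 * w.
    by apply: T1; lia.
  have [|||||t E T] := IH s' Vk => //; rewrite ?s'1 //; first by lia.
  have b1 : bounded (Vk + growth c N) (run c s') by apply: run_bounded; rewrite ?s'1.
  have T2 : eval_time (run c s') (Bin Add (Reg i) (Const 1)) <= 9 * w.
    by apply: TE => //; apply: bounded_le b1; lia.
  have fi : regs (f s') i = n - k.
    by rewrite /= /update eqxx run_reg_frame // s'i; lia.
  have [|||||| t' E' T'] := IHk (f s') (Vk + growth c N + 1) => //.
  + by lia.
  + by rewrite /= /update eq_sym (negPf i1) wf_reg1.
  + by lia.
  + apply: bounded_set_reg; last by rewrite leq_add2r; case: b1.
    by apply: bounded_le b1; lia.
  + by lia.
  rewrite iterSr.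
  exists (eval_time s' (Bin Sub (Reg 1) (Reg i)) +
     (t + (eval_time (run c s') (Bin Add (Reg i) (Const 1))).+1) + t').+1.
    apply: exec_WhileTrue E'; first by rewrite /= s'1 s'i; lia.
    exact: exec_Seq E (exec_SetReg _ _ _).
  by lia.
have [| | | | | |t E T] := W (set_reg i 0 s) n V => //=.
- by rewrite /update eq_sym (negPf i1).
- by rewrite /update eqxx subnn.
- by apply: bounded_set_reg.
- by have : n * (growth c N + 1) <= N * (growth c N + 1);
    [rewrite leq_mul2r sN orbT | lia].
exists ((eval_time s (Const 0)).+1 + t).
  exact: exec_Seq (exec_SetReg s i (Const 0)) E.
have T0 : eval_time s (Const 0) <= 1 * w.
  by apply: (TE s (Const 0)) => //; apply: bounded_le bV; lia.
have : n * (time_bound c N w + 18 * w + 2) <= N * (time_bound c N w + 18 * w + 2).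
  by rewrite leq_mul2r sN orbT.
lia.
Qed.

(** * Closure properties of polynomially bounded functions *)

Definition poly_bounded (f : nat -> nat) : Prop :=
  exists p : {poly nat}, forall N, f N <= p.[N]%R.

Lemma poly_bounded_const a : poly_bounded (fun=> a).
Proof. by exists (a%:P)%R => N; rewrite hornerC. Qed.

Lemma poly_bounded_id : poly_bounded id.
Proof. by exists 'X%R => N; rewrite hornerX. Qed.

Lemma poly_bounded_add f g :
  poly_bounded f -> poly_bounded g -> poly_bounded (fun N => f N + g N).
Proof. by move=> [p hp] [q hq]; exists (p + q)%R => N; rewrite hornerD leq_add. Qed.

Lemma poly_bounded_mul f g :
  poly_bounded f -> poly_bounded g -> poly_bounded (fun N => f N * g N).
Proof. by move=> [p hp] [q hq]; exists (p * q)%R => N; rewrite hornerM leq_mul. Qed.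

Lemma poly_bounded_growth c : poly_bounded (growth c).
Proof.
elim: c => [|i e|e1 e2|c1 IH1 c2 IH2|e c1 IH1 c2 IH2|i c IH] /=;
  try exact: poly_bounded_const; try exact: poly_bounded_add.
apply: poly_bounded_mul poly_bounded_id (poly_bounded_add IH _).
exact: poly_bounded_const.
Qed.

Lemma poly_bounded_time c w :
  poly_bounded w -> poly_bounded (fun N => time_bound c N (w N)).
Proof.
move=> hw; have Bc := poly_bounded_const.
elim: c => [|i e|e1 e2|c1 IH1 c2 IH2|e c1 IH1 c2 IH2|i c IH] /=;
  repeat first [exact: poly_bounded_id | exact: IH | exact: IH1 | exact: IH2
    | exact: hw | exact: Bc | apply: poly_bounded_add | apply: poly_bounded_mul].
Qed.

(** * The greedy algorithm for a fixed radius *)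

Local Open Scope ring_scope.

Section Greedy.

Variables (I : instance) (R : rat).
Hypothesis R_ge0 : 0 <= R.

Notation X := (space I).
Notation d := (@dist I).
Notation P := (points I).
Notation L := (locations I).
Notation k := (max_centers I).
Notation ell := (lower_bound I).

Definition ball (r : rat) (v : X) : {set X} := [set u in P | d v u <= r].

Notation G := (ball (2 * R)).
Notation E := (ball (4 * R)).

Lemma dist_xx (x : X) : d x x = 0.
Proof. by case: (dist_metric I) => _ /(_ x x) [_ ->]. Qed.

Lemma distC (x y : X) : d x y = d y x.
Proof. by case: (dist_metric I). Qed.

Lemma dist_triangle (x y z : X) : d x z <= d x y + d y z.
Proof. by case: (dist_metric I). Qed.

Lemma dist_ge0 (x y : X) : 0 <= d x y.
Proof. by case: (dist_metric I). Qed.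

Lemma ball_sub v : G v \subset E v.
Proof.
apply/subsetP => u; rewrite !inE => /andP[-> /le_trans -> //].
by rewrite ler_wpM2r.
Qed.

Definition candidate (U : {set X}) (v : X) : bool :=
  [&& v \in P, v \notin U, (ell <= #|G v|)%N
    & [exists c, (c \in L) && (d v c <= R)]].

(* Taking a point as its own center when possible saves [R] if [P = L]. *)
Definition serves (c v : X) : Prop :=
  [/\ c \in L, d v c <= R & v \in L -> c = v].

(** The invariant after [p] picks, with covered set [U]. Each center keeps a witness [v]: the points
    of [G v] give it enough load, and [E v \subset U] keeps later picks away from [G v]. *)
Definition clustering (p : nat) (U C : {set X}) (f : X -> X) : Prop :=
  [/\ U \subset P, C \subset L, (#|C| <= p <= k)%N,
      {in U, forall u, [/\ f u \in C, d u (f u) <= 5 * R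
                         & P = L -> d u (f u) <= 4 * R]}
    & {in C, forall c, exists v,
        [/\ (ell <= #|G v|)%N, E v \subset U & {in G v, forall u, f u = c}]}].

Lemma clustering0 f : clustering 0 set0 set0 f.
Proof.
split; rewrite ?sub0set ?cards0 //; first by move=> u; rewrite inE.
by move=> c; rewrite inE.
Qed.

(* The new point lies outside every older [E v], hence its ball of radius
   [2 * R] is disjoint from every older [G v]. *)
Lemma clustering_step p U C f v c f' :
  clustering p U C f -> (p < k)%N -> candidate U v -> serves c v ->
  (forall u, f' u = if u \in G v :|: (E v :\: U) then c else f u) ->
  clustering p.+1 (U :|: E v) (c |: C) f'.
Proof.
move=> [UP CL /andP[Cp pk] Uf Cw] pk' /and4P[vP vU Gv _] [cL vc cv] f'E.
have EP : E v \subset P by apply/subsetP => u; rewrite inE => /andP[].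
split.
- by rewrite subUset UP.
- by rewrite subUset sub1set cL.
- rewrite cardsU1 pk' andbT; case: (c \notin C); lia.
- move=> u uU; rewrite f'E; case: ifP => [uG|uG].
    have uE : u \in E v.
      by case/setUP: uG => [/(subsetP (ball_sub v)) //|/setDP[]].
    move: uE; rewrite inE => /andP[uP uv].
    split; first by rewrite setU11.
    (* At most [4 * R] to the picked point and [R] from there to its center; if [P = L], the two
       coincide and only [4 * R] remains. *)
    + by have := dist_triangle u v c; rewrite (distC u v); lra.
    + by move=> PL; rewrite cv -?PL // distC.
  have uU' : u \in U.
    case/setUP: uU => // uE; apply: contraFT uG => uU.
    by rewrite !in_setU in_setD uU uE orbT.
  have [h1 h2 h3] := Uf _ uU'; split=> //.
  by rewrite in_setU h1 orbT.
move=> c' /setU1P[->|c'C].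
  exists v; split=> //; first exact: subsetUr.
  by move=> u uG; rewrite f'E in_setU uG.
have [w [Gw Ew fw]] := Cw _ c'C; exists w; split=> //.
  exact: subset_trans Ew (subsetUl _ _).
move=> u uG; rewrite f'E ifF ?fw //.
have uU : u \in U by apply: (subsetP Ew); apply: (subsetP (ball_sub w)).
apply/negbTE; rewrite in_setU in_setD uU /= orbF.
apply: contra vU => uv; apply: (subsetP Ew).
move: uv uG; rewrite !inE vP /= => /andP[_ uv] /andP[_ uw].
by have := dist_triangle w u v; rewrite (distC u v); lra.
Qed.

(* The properties used of the clusters of a feasible solution of value at most
   [R]. *)
Definition cluster (O : {set X}) : Prop :=
  [/\ O \subset P, (ell <= #|O|)%N, {in O &, forall x y, d x y <= 2 * R}
    & {in O, forall x, exists2 c, c \in L & d x c <= R}].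

(** An exchange property: any [k] clusters can be traded for [U] and [k - p] clusters without losing
    covered points. Quantifying over all families keeps the optimal solution out of the
    invariant. *)
Definition cover_bound (p : nat) (U : {set X}) : Prop :=
  forall F : seq {set X}, {in F, forall O, cluster O} -> (size F <= k)%N ->
  exists F' : seq {set X}, [/\ {in F', forall O, cluster O},
    (size F' + p <= k)%N
    & (#|\bigcup_(O <- F) O| <= #|U :|: \bigcup_(O <- F') O|)%N].

Lemma cover_bound0 : cover_bound 0 set0.
Proof. by move=> F FC Fk; exists F; split; rewrite ?addn0 ?set0U. Qed.

Lemma bigcup_seq_sup (F : seq {set X}) O x :
  O \in F -> x \in O -> x \in \bigcup_(A <- F) A.
Proof.
elim: F => [//|A F IH]; rewrite in_cons big_cons in_setU => /orP[/eqP <- -> //|].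
by move=> /IH h /h ->; rewrite orbT.
Qed.

Lemma cluster_sub_ball (O : {set X}) x : cluster O -> x \in O -> O \subset G x.
Proof.
move=> [OP _ Od _] xO; apply/subsetP => y yO.
by rewrite inE (subsetP OP) ?Od.
Qed.

Lemma cluster_candidate (U O : {set X}) x :
  cluster O -> x \in O -> x \notin U -> candidate U x.
Proof.
move=> cO xO xU; have [OP Ol _ Oc] := cO.
rewrite /candidate (subsetP OP) // xU /=; apply/andP; split.
  exact: leq_trans Ol (subset_leq_card (cluster_sub_ball cO xO)).
by have [c cL dc] := Oc _ xO; apply/existsP; exists c; rewrite cL.
Qed.

(* Charging argument: either [G v] meets one of the remaining clusters, which
   is then contained in [E v], or the points of [G v] pay for any one of them,
   by the maximality of [v]. *)
Lemma cover_bound_step p U v :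
  cover_bound p U -> (p < k)%N ->
  (forall w, candidate U w -> (#|G w :\: U| <= #|G v :\: U|)%N) ->
  cover_bound p.+1 (U :|: E v).
Proof.
move=> cb pk vmax F FC Fk; have {cb} [F' [F'C F'k cF]] := cb F FC Fk.
case: (boolP [exists x in G v, x \in \bigcup_(O <- F') O]).
  case/exists_inP => x xG.
  rewrite bigcup_seq => /bigcupP[O OF' xO].
  exists (rem O F'); split.
  - by move=> A /mem_rem /F'C.
  - by rewrite size_rem // addnS -addSn prednK //; case: (F') OF'.
  apply: leq_trans cF (subset_leq_card _).
  rewrite (perm_big _ (perm_to_rem OF')) big_cons /=.
  rewrite subUset -setUA subsetUl /= subUset; apply/andP; split; last first.
    by rewrite setUA subsetUr.
  apply: subset_trans (subset_trans (subsetUl _ _) (subsetUr _ _)).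
  apply/subsetP => y yO; have [OP _ Od _] := F'C _ OF'.
  rewrite inE (subsetP OP) //=.
  move: xG; rewrite inE => /andP[_ vx]; have xy := Od _ _ xO yO.
  (* [x] lies within [2 * R] of [v], and [y] within [2 * R] of [x], so the whole cluster falls into
     [E v]. *)
  by have := dist_triangle v x y; lra.
rewrite negb_exists_in => /forall_inP Gdis.
(* No remaining cluster meets [G v]. If there is none at all, nothing has to be paid for; otherwise
   an arbitrary one, [O], is dropped. *)
case: F' => [|O F'] in F'C F'k cF Gdis.
  exists [::]; split=> //; apply: leq_trans cF (subset_leq_card _).
  by rewrite big_nil !setU0 subsetUl.
exists F'; split.
- by move=> A AF; apply: F'C; rewrite in_cons AF orbT.
- by move: F'k => /=; lia.
rewrite big_cons in cF Gdis.
set B := \bigcup_(A <- F') A in cF Gdis *.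
(* An uncovered point [x] of [O] is itself a candidate and [O \subset G x], so the maximality of [v]
   applies. *)
have OG : (#|O :\: U| <= #|G v :\: U|)%N.
  case: (set_0Vmem (O :\: U)) => [->|[x /setDP[xO xU]]]; first by rewrite cards0.
  have cO : cluster O by apply: F'C; rewrite mem_head.
  apply: leq_trans (vmax x (cluster_candidate cO xO xU)).
  by rewrite subset_leq_card // setSD // cluster_sub_ball.
apply: leq_trans cF _.
have -> : U :|: (O :|: B) = (U :|: B) :|: (O :\: U).
  by apply/setP => x; rewrite !inE; do !case: (_ \in _).
apply: (leq_trans (leq_card_setU _ _)).
apply: (leq_trans (leq_add (leqnn _) OG)).
(* The uncovered part of [G v] is disjoint from [U] and from the clusters kept, so its cardinality
   adds to theirs. *)
rewrite -cardsUI.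
have -> : (U :|: B) :&: (G v :\: U) = set0.
  apply/setP => x; rewrite !in_setI in_setU in_setD in_set0.
  case: (boolP (x \in U)) => //= xU; case: (boolP (x \in G v)) => xG; rewrite ?andbF //.
  by have := Gdis _ xG; rewrite in_setU negb_or => /andP[_ /negPf ->].
rewrite cards0 addn0; apply: subset_leq_card.
rewrite subUset setSU ?subsetUl //=; apply/subsetP => x /setDP[xG _].
by rewrite !in_setU (subsetP (ball_sub v)) ?orbT.
Qed.

(** After [k] picks no cluster is left over; if no candidate remains, the leftover clusters lie in
    [U], since an uncovered point of a cluster would be a candidate. *)
Lemma cover_bound_final p U (F : seq {set X}) :
  cover_bound p U -> p = k \/ (forall v, ~~ candidate U v) ->
  {in F, forall O, cluster O} -> (size F <= k)%N ->
  (#|\bigcup_(O <- F) O| <= #|U|)%N.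
Proof.
move=> cb stuck FC Fk; have [F' [F'C F'k cF]] := cb F FC Fk.
apply: leq_trans cF (subset_leq_card _).
rewrite subUset subxx /=; case: stuck => [pk|noc].
  by case: F' F'k {F'C} => [_|O F' /=]; [rewrite big_nil sub0set | lia].
rewrite bigcup_seq; apply/bigcupsP => O OF; apply/subsetP => x xO.
apply: contraT => xU.
by have := noc x; rewrite (cluster_candidate (F'C _ OF) xO xU).
Qed.

Lemma le_objective (S : solution X) x :
  x \in served S -> d x (assignment S x) <= objective S.
Proof. by move=> xS; rewrite /objective (bigD1 x) //= le_max lexx. Qed.

(** The fibers of the assignment of [S] are at most [k] clusters that cover all served points, so
    [U] has at least as many points as [S] serves. *)
Lemma few_uncovered (S : solution X) p (U : {set X}) :
  feasible S -> objective S <= R -> U \subset P ->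
  cover_bound p U -> p = k \/ (forall v, ~~ candidate U v) ->
  (#|P :\: U| <= max_outliers I)%N.
Proof.
move=> [CL Ck OP Oo [aC Cl]] SR UP cb stuck.
pose cl c := [set x in served S | assignment S x == c].
have := cover_bound_final (F := [seq cl c | c <- enum (centers S)]) cb stuck.
rewrite size_map -cardE => /(_ _ Ck).
have clC : {in [seq cl c | c <- enum (centers S)], forall O, cluster O}.
  move=> O /mapP[c]; rewrite mem_enum => cC ->.
  have dc x : x \in cl c -> d x c <= R.
    by rewrite inE => /andP[xS /eqP <-]; apply: le_trans (le_objective xS) SR.
  split.
  - by apply/subsetP => x; rewrite !inE => /andP[/andP[]].
  - exact: Cl.
  - move=> x y /dc xc /dc yc; have := dist_triangle x c y.
    by rewrite (distC c y); lra.
  - by move=> x /dc xc; exists c => //; apply: (subsetP CL).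
move=> /(_ clC); rewrite big_map => cU.
have sU : (#|served S| <= #|U|)%N.
  apply: leq_trans cU; apply: subset_leq_card; apply/subsetP => x xS.
  rewrite -(big_map cl xpredT id) /=.
  apply: (@bigcup_seq_sup _ (cl (assignment S x))).
    by apply: map_f; rewrite mem_enum aC.
  by rewrite inE xS eqxx.
move: sU; rewrite /served !cardsD (setIidPr OP) (setIidPr UP).
have := subset_leq_card UP; have := subset_leq_card OP; lia.
Qed.

(** With [P :\: U] as outliers, the served set is [U], and the ball [G v] of a center's witness lies
    in its fiber. *)
Lemma clustering_feasible p U C f :
  clustering p U C f -> (#|P :\: U| <= max_outliers I)%N ->
  let S := Solution C (P :\: U) [ffun x => f x] in
  [/\ feasible S, objective S <= 5 * R & P = L -> objective S <= 4 * R].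
Proof.
move=> [UP CL /andP[Cp pk] Uf Cw] Uo S.
have SE : served S = U.
  by rewrite /served setDDr setDv set0U; apply/setIidPr.
split.
- split=> //.
  + exact: leq_trans Cp pk.
  + exact: subsetDl.
  rewrite SE; split=> [x xU|c cC]; first by rewrite ffunE; case: (Uf _ xU).
  have [v [Gl EU fG]] := Cw _ cC; apply: leq_trans Gl (subset_leq_card _).
  apply/subsetP => u uG; rewrite in_set ffunE fG // eqxx andbT.
  by apply: (subsetP EU); apply: (subsetP (ball_sub v)).
- rewrite /objective SE; apply: bigmax_le; first by rewrite mulr_ge0.
  by move=> x xU; rewrite ffunE; case: (Uf _ xU).
- move=> PL; rewrite /objective SE; apply: bigmax_le; first by rewrite mulr_ge0.
  by move=> x xU; rewrite ffunE; case: (Uf _ xU) => _ _; apply.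
Qed.

End Greedy.

(** * The program *)

Local Open Scope nat_scope.

(** Tests evaluate to 0 or 1: the truncated difference vanishes exactly when the comparison holds,
    and conjunction is multiplication. *)
Definition eLe (e1 e2 : expr) : expr := Bin Sub (Const 1) (Bin Sub e1 e2).
Definition eLt (e1 e2 : expr) : expr := eLe (Bin Add e1 (Const 1)) e2.
Definition eNot (e : expr) : expr := Bin Sub (Const 1) e.
Definition eAnd (e1 e2 : expr) : expr := Bin Mul e1 e2.
Definition eOr (e1 e2 : expr) : expr := eNot (eAnd (eNot e1) (eNot e2)).
Definition eSucc (i : nat) : expr := Bin Add (Reg i) (Const 1).

(** The offsets follow the encoding: four numbers, two indicator arrays of length [n], then the
    [n * n] numerators and the [n * n] denominators, row by row. *)
Definition ePoint (e : expr) : expr := Mem (Bin Add (Const 4) e).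
Definition eLoc (e : expr) : expr :=
  Mem (Bin Add (Bin Add (Const 4) (Reg 1)) e).
Definition eBase : expr := Bin Add (Bin Add (Const 4) (Reg 1)) (Reg 1).
Definition ePair (e1 e2 : expr) : expr := Bin Add (Bin Mul e1 (Reg 1)) e2.
Definition eNum (e1 e2 : expr) : expr := Mem (Bin Add eBase (ePair e1 e2)).
Definition eDen (e1 e2 : expr) : expr :=
  Mem (Bin Add (Bin Add eBase (Bin Mul (Reg 1) (Reg 1))) (ePair e1 e2)).

(* Tests [d e1 e2 <= a * d e3 e4]. *)
Definition eDistLe (a : nat) (e1 e2 e3 e4 : expr) : expr :=
  eLe (Bin Mul (eNum e1 e2) (eDen e3 e4))
      (Bin Mul (Bin Mul (Const a) (eNum e3 e4)) (eDen e1 e2)).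

Definition eNear (a : nat) (e1 e2 : expr) : expr :=
  eDistLe a e1 e2 (Reg 3) (Reg 4).

(* Beyond the input, the memory holds arrays of length [n]: 0 = covered
   points, 1 = centers, 2 = assignment of the current run of the greedy
   algorithm; 3 = centers, 4 = outliers, 5 = assignment of the best solution
   found so far. Register 2 holds the length of the input. *)
Definition eAddr (a : nat) (e : expr) : expr :=
  Bin Add (Bin Add (Reg 2) (Bin Mul (Const a) (Reg 1))) e.
Definition eArr (a : nat) (e : expr) : expr := Mem (eAddr a e).

(* Registers: 3, 4 = the pair whose distance is the radius; 5 = iteration of
   the greedy algorithm; 6 = candidate point; 7 = innermost loop; 8, 9 =
   numbers of uncovered points and of points near the candidate; 10 = center
   for the candidate plus 1, or 0; 11, 12, 13 = number of uncovered points near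
   the best candidate, this candidate and its center; 14 = number of picks;
   15 = whether a solution has been found; 16, 17 = pair whose distance is the
   radius of that solution; 18 = number of uncovered points. *)

Definition inspect_body : lcmd :=
  LSeq (LIf (eAnd (ePoint (Reg 7)) (eNear 2 (Reg 6) (Reg 7)))
          (LSeq (LReg 9 (eSucc 9))
             (LIf (eNot (eArr 0 (Reg 7))) (LReg 8 (eSucc 8)) LSkip))
          LSkip)
       (LIf (eAnd (eLoc (Reg 7)) (eNear 1 (Reg 6) (Reg 7)))
          (LReg 10 (eSucc 7)) LSkip).

(** The last test overrides any location found by the loop, so that a candidate that is a location
    becomes its own center. *)
Definition inspect : lcmd :=
  LSeq (LReg 8 (Const 0)) (LSeq (LReg 9 (Const 0)) (LSeq (LReg 10 (Const 0))
    (LSeq (LFor 7 inspect_body)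
       (LIf (eLoc (Reg 6)) (LReg 10 (eSucc 6)) LSkip)))).

(** A candidate counts itself among the uncovered points near it, so the strict comparison accepts a
    first candidate even from the initial value 0. Hence 0 in register 11 means that no candidate
    exists. *)
Definition eBetter : expr :=
  eAnd (eAnd (eAnd (eAnd (ePoint (Reg 6)) (eNot (eArr 0 (Reg 6))))
                   (eLt (Const 0) (Reg 10)))
             (eLe (Mem (Const 2)) (Reg 9)))
       (eLt (Reg 11) (Reg 8)).

Definition select : lcmd :=
  LSeq (LReg 11 (Const 0))
    (LFor 6 (LSeq inspect
       (LIf eBetter
          (LSeq (LReg 11 (Reg 8)) (LSeq (LReg 12 (Reg 6))
             (LReg 13 (Bin Sub (Reg 10) (Const 1)))))
          LSkip))).

(** Points of [G v] are reassigned even if already covered, to reach the lower bound; the other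
    points of [E v] change center only if uncovered. *)
Definition pick_body : lcmd :=
  LIf (eAnd (ePoint (Reg 7))
         (eOr (eNear 2 (Reg 12) (Reg 7))
              (eAnd (eNot (eArr 0 (Reg 7))) (eNear 4 (Reg 12) (Reg 7)))))
    (LSeq (LMem (eAddr 0 (Reg 7)) (Const 1))
          (LMem (eAddr 2 (Reg 7)) (Reg 13)))
    LSkip.

Definition pick : lcmd :=
  LSeq (LReg 14 (eSucc 14))
    (LSeq (LMem (eAddr 1 (Reg 13)) (Const 1)) (LFor 7 pick_body)).

(** The default assignment is the identity, so that outliers also receive the rank of an element, as
    the encoding of a solution demands. *)
Definition clear_body : lcmd :=
  LSeq (LMem (eAddr 0 (Reg 7)) (Const 0))
    (LSeq (LMem (eAddr 1 (Reg 7)) (Const 0)) (LMem (eAddr 2 (Reg 7)) (Reg 7))).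

Definition greedy_body : lcmd :=
  LSeq select
    (LIf (eAnd (eLt (Const 0) (Reg 11)) (eLt (Reg 14) (Mem (Const 1))))
       pick LSkip).

Definition greedy : lcmd :=
  LSeq (LReg 14 (Const 0)) (LSeq (LFor 7 clear_body) (LFor 5 greedy_body)).

Definition eUncovered : expr :=
  eAnd (ePoint (Reg 7)) (eNot (eArr 0 (Reg 7))).

Definition count_uncovered : lcmd :=
  LSeq (LReg 18 (Const 0))
    (LFor 7 (LIf eUncovered (LReg 18 (eSucc 18)) LSkip)).

Definition save_body : lcmd :=
  LSeq (LMem (eAddr 3 (Reg 7)) (eArr 1 (Reg 7)))
    (LSeq (LMem (eAddr 4 (Reg 7)) (Const 0))
       (LSeq (LMem (eAddr 5 (Reg 7)) (eArr 2 (Reg 7)))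
          (LIf eUncovered (LMem (eAddr 4 (Reg 7)) (Const 1)) LSkip))).

Definition save : lcmd :=
  LSeq (LReg 15 (Const 1)) (LSeq (LReg 16 (Reg 3)) (LSeq (LReg 17 (Reg 4))
    (LFor 7 save_body))).

Definition trial : lcmd :=
  LSeq greedy (LSeq count_uncovered
    (LIf (eLe (Reg 18) (Mem (Const 3))) save LSkip)).

(** A radius is tried only if nothing has been found yet or if it is strictly smaller than the best
    one so far. *)
Definition search_body : lcmd :=
  LIf (eOr (eNot (Reg 15))
         (eNot (eDistLe 1 (Reg 16) (Reg 17) (Reg 3) (Reg 4))))
    trial LSkip.

Definition search : lcmd := LFor 3 (LFor 4 search_body).

(** The output overwrites the input, while the saved arrays lie beyond it. Register 0 reaches
    [3 * n] by steps of 3, because [additive] excludes products. *)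
Definition write_body : lcmd :=
  LSeq (LReg 0 (Bin Add (Reg 0) (Const 3)))
    (LSeq (LMem (Reg 7) (eArr 3 (Reg 7)))
       (LSeq (LMem (Bin Add (Reg 1) (Reg 7)) (eArr 4 (Reg 7)))
          (LMem (Bin Add (Bin Add (Reg 1) (Reg 1)) (Reg 7))
             (eArr 5 (Reg 7))))).

Definition write_output : lcmd :=
  LSeq (LReg 0 (Const 0)) (LFor 7 write_body).

Definition main_loop : lcmd := LSeq search write_output.

(** The prologue stays outside the bounded-loop language, where register 1 cannot be assigned. *)
Definition approx_cmd : cmd :=
  Seq (SetReg 2 (Reg 0)) (Seq (SetReg 1 (Mem (Const 0))) (compile main_loop)).

Lemma wf_main_loop : wf main_loop.
Proof. by []. Qed.

(** * Correctness of the program *)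

Section Correctness.

Variable I : instance.

Notation X := (space I).
Notation P := (points I).
Notation L := (locations I).
Notation input := (encode_instance I).
Notation n := #|X|.

(** * Numbering of the space and layout of the encoded instance *)

Definition rk (x : X) : nat := enum_rank x.

Lemma rk_lt x : rk x < n.
Proof. exact: ltn_ord. Qed.

Lemma rk_inj : injective rk.
Proof. by move=> x y h; apply: enum_rank_inj; apply: val_inj. Qed.

Lemma rk_surj j : j < n -> exists x, rk x = j.
Proof. by move=> jn; exists (enum_val (Ordinal jn)); rewrite /rk enum_valK. Qed.

Lemma nth_enum_map (T : Type) (z : T) (f : X -> T) x :
  nth z [seq f y | y <- enum X] (rk x) = f x.
Proof.
by rewrite (nth_map x) -?cardE ?rk_lt // nth_enum_rank.
Qed.

Lemma nth_enum_allpairs (f : X -> X -> nat) x y :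
  nth 0 [seq f u v | u <- enum X, v <- enum X] (rk x * n + rk y) = f x y.
Proof.
have H (s : seq X) j : j < size s ->
    nth 0 [seq f u v | u <- s, v <- enum X] (j * n + rk y) = f (nth x s j) y.
  elim: s j => [|u s IH] [|j] //= jn.
    by rewrite nth_cat size_map -cardE rk_lt nth_enum_map.
  rewrite nth_cat size_map -cardE ifF; last by lia.
  by rewrite mulSn -addnA addKn IH.
by rewrite H -?cardE ?rk_lt // nth_enum_rank.
Qed.

Lemma size_input : size input = 4 + n + n + n * n + n * n.
Proof.
rewrite /encode_instance /encode_set !size_cat !size_map !size_allpairs.
by rewrite -?enumT -!cardT /=; lia.
Qed.

Lemma nth_cat_l (s1 s2 : seq nat) i :
  i < size s1 -> nth 0 (s1 ++ s2) i = nth 0 s1 i.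
Proof. by move=> h; rewrite nth_cat h. Qed.

Lemma nth_cat_r (s1 s2 : seq nat) m i :
  size s1 = m -> nth 0 (s1 ++ s2) (m + i) = nth 0 s2 i.
Proof. by move=> <-; rewrite nth_cat ltnNge leq_addr addKn. Qed.

Lemma size_encode_set (A : {set X}) : size (encode_set A) = n.
Proof. by rewrite size_map -cardE. Qed.

Lemma size_enum_allpairs (f : X -> X -> nat) :
  size [seq f u v | u <- enum X, v <- enum X] = n * n.
Proof. by rewrite size_allpairs -!cardE. Qed.

Lemma pair_lt x y : rk x * n + rk y < n * n.
Proof.
apply: (@leq_trans (rk x * n + n)); first by rewrite ltn_add2l rk_lt.
by rewrite -mulSnr leq_mul2r rk_lt orbT.
Qed.

Lemma nth_points x : nth 0 input (4 + rk x) = (x \in P).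
Proof.
rewrite /encode_instance (@nth_cat_r [:: _; _; _; _] _ 4 _ erefl) nth_cat_l.
  exact: nth_enum_map.
by rewrite size_encode_set rk_lt.
Qed.

Lemma nth_locations x : nth 0 input (4 + n + rk x) = (x \in L).
Proof.
rewrite -addnA /encode_instance (@nth_cat_r [:: _; _; _; _] _ 4 _ erefl).
rewrite (nth_cat_r _ _ (size_encode_set _)) nth_cat_l.
  exact: nth_enum_map.
by rewrite size_encode_set rk_lt.
Qed.

Lemma nth_num x y :
  nth 0 input (4 + n + n + (rk x * n + rk y)) = `|numq (dist x y)|%N.
Proof.
rewrite -!addnA /encode_instance (@nth_cat_r [:: _; _; _; _] _ 4 _ erefl).
rewrite !(nth_cat_r _ _ (size_encode_set _)) nth_cat_l.
  exact: (nth_enum_allpairs (fun u v => `|numq (dist u v)|%N)).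
by rewrite size_enum_allpairs pair_lt.
Qed.

Lemma nth_den x y :
  nth 0 input (4 + n + n + n * n + (rk x * n + rk y)) = `|denq (dist x y)|%N.
Proof.
rewrite -!addnA /encode_instance (@nth_cat_r [:: _; _; _; _] _ 4 _ erefl).
rewrite !(nth_cat_r _ _ (size_encode_set _)).
rewrite (nth_cat_r _ _ (size_enum_allpairs _)).
exact: (nth_enum_allpairs (fun u v => `|denq (dist u v)|%N)).
Qed.

(** Multiplication by the positive denominators turns the comparison into one of natural numbers;
    nonnegativity removes the absolute values. *)
Lemma le_cross_mul (a : nat) (q r : rat) : (0 <= q)%R -> (0 <= r)%R ->
  (`|numq q| * `|denq r| <= a * `|numq r| * `|denq q|) = (q <= a%:R * r)%R.
Proof.
move=> q0 r0; rewrite -(ler_nat rat) !natrM !natr_absz.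
rewrite !ger0_norm ?numq_ge0 ?(ltW (denq_gt0 _)) // !numqE.
have Dq : (0 < (denq q)%:~R :> rat)%R by rewrite ltr0z denq_gt0.
have Dr : (0 < (denq r)%:~R :> rat)%R by rewrite ltr0z denq_gt0.
rewrite -[RHS](ler_pM2r (mulr_gt0 Dq Dr)); congr (_ <= _)%R; ring.
Qed.

(** * States with intact input, and the arrays beyond it *)

Definition env (s : state) : Prop :=
  [/\ regs s 1 = n, regs s 2 = size input
    & forall a, a < size input -> mem s a = nth 0 input a].

Definition arr (s : state) (a : nat) (x : X) : nat :=
  mem s (size input + a * n + rk x).

Lemma env_frame s s' : env s -> regs s' 1 = regs s 1 ->
  regs s' 2 = regs s 2 -> mem s' = mem s -> env s'.
Proof. by move=> [h1 h2 h3] r1 r2 m; split; rewrite ?r1 ?r2 // => a; rewrite m; apply: h3. Qed.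

Lemma env_set_reg s i v : (i != 1) && (i != 2) -> env s -> env (set_reg i v s).
Proof.
move=> /andP[i1 i2] [h1 h2 h3]; split=> //=; rewrite /update.
- by rewrite eq_sym (negPf i1).
- by rewrite eq_sym (negPf i2).
Qed.

Lemma env_set_arr s a x v :
  env s -> env (set_mem (size input + a * n + rk x) v s).
Proof.
move=> [h1 h2 h3]; split=> //= b bS; rewrite /update ifF ?h3 //.
by apply/eqP; lia.
Qed.

Lemma arr_set_arr s a x v b y :
  arr (set_mem (size input + a * n + rk x) v s) b y =
  if (a == b) && (x == y) then v else arr s b y.
Proof.
rewrite /arr /= /update -!addnA eqn_add2l.
have -> // : (b * n + rk y == a * n + rk x) = (a == b) && (x == y).
have hx := rk_lt x; have hy := rk_lt y.
apply/eqP/andP => [h|[/eqP -> /eqP ->] //].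
have n0 : 0 < n by apply: leq_ltn_trans hx.
(* Ranks are below [n], so division by [n] recovers the array index from the address. *)
have ab : a = b.
  have := congr1 (divn^~ n) h.
  by rewrite !divnMDl // !divn_small // !addn0.
split; first by apply/eqP.
by move: h; rewrite ab => /addnI /rk_inj ->.
Qed.

Lemma arr_frame s s' a x : mem s' = mem s -> arr s' a x = arr s a x.
Proof. by rewrite /arr => ->. Qed.

Lemma env_mem1 s : env s -> mem s 1 = max_centers I.
Proof. by case=> _ _ h; rewrite h. Qed.

Lemma env_mem2 s : env s -> mem s 2 = lower_bound I.
Proof. by case=> _ _ h; rewrite h. Qed.

Lemma env_mem3 s : env s -> mem s 3 = max_outliers I.
Proof. by case=> _ _ h; rewrite h. Qed.

Section Eval.

Variable s : state.
Hypothesis es : env s.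

Lemma eval_point e x : eval s e = rk x -> eval s (ePoint e) = (x \in P).
Proof.
case: es => h1 h2 h3 ex; rewrite -nth_points -h3; first by rewrite /= ex.
by rewrite size_input; have := rk_lt x; lia.
Qed.

Lemma eval_loc e x : eval s e = rk x -> eval s (eLoc e) = (x \in L).
Proof.
case: es => h1 h2 h3 ex; rewrite -nth_locations -h3; first by rewrite /= ex h1.
by rewrite size_input; have := rk_lt x; lia.
Qed.

Lemma eval_num e1 e2 x y : eval s e1 = rk x -> eval s e2 = rk y ->
  eval s (eNum e1 e2) = `|numq (dist x y)|%N.
Proof.
case: es => h1 h2 h3 ex ey; rewrite -nth_num -h3; first by rewrite /= ex ey ?h1.
by rewrite size_input; have := pair_lt x y; lia.
Qed.

Lemma eval_den e1 e2 x y : eval s e1 = rk x -> eval s e2 = rk y ->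
  eval s (eDen e1 e2) = `|denq (dist x y)|%N.
Proof.
case: es => h1 h2 h3 ex ey; rewrite -nth_den -h3; first by rewrite /= ex ey ?h1.
by rewrite size_input; have := pair_lt x y; lia.
Qed.

Lemma eval_le_expr e1 e2 : eval s (eLe e1 e2) = (eval s e1 <= eval s e2).
Proof. by rewrite /=; case: leqP; lia. Qed.

Lemma eval_lt_expr e1 e2 : eval s (eLt e1 e2) = (eval s e1 < eval s e2).
Proof. by rewrite eval_le_expr /= addn1. Qed.

Lemma eval_dist_le a e1 e2 e3 e4 x1 x2 x3 x4 :
  eval s e1 = rk x1 -> eval s e2 = rk x2 ->
  eval s e3 = rk x3 -> eval s e4 = rk x4 ->
  eval s (eDistLe a e1 e2 e3 e4) =
    (dist x1 x2 <= a%:R * dist x3 x4)%R.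
Proof.
move=> h1 h2 h3 h4; rewrite eval_le_expr -le_cross_mul ?dist_ge0 //.
change (nat_of_bool (eval s (eNum e1 e2) * eval s (eDen e3 e4) <=
  a * eval s (eNum e3 e4) * eval s (eDen e1 e2)) =
  (`|numq (dist x1 x2)| * `|denq (dist x3 x4)| <=
   a * `|numq (dist x3 x4)| * `|denq (dist x1 x2)|)).
by rewrite !(eval_num h1 h2, eval_num h3 h4, eval_den h1 h2, eval_den h3 h4).
Qed.

Lemma eval_addr a e x : eval s e = rk x ->
  eval s (eAddr a e) = size input + a * n + rk x.
Proof. by case: es => h1 h2 _ /= ->; rewrite h1 h2. Qed.

Lemma eval_arr a e x : eval s e = rk x -> eval s (eArr a e) = arr s a x.
Proof. by move=> ex; rewrite /arr -(eval_addr a ex). Qed.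

Lemma eval_not e (b : bool) : eval s e = b -> eval s (eNot e) = ~~ b.
Proof. by move=> /= ->; case: b. Qed.

Lemma eval_and e1 e2 (b1 b2 : bool) :
  eval s e1 = b1 -> eval s e2 = b2 -> eval s (eAnd e1 e2) = b1 && b2.
Proof. by move=> /= -> ->; rewrite mulnb. Qed.

Lemma eval_or e1 e2 (b1 b2 : bool) :
  eval s e1 = b1 -> eval s e2 = b2 -> eval s (eOr e1 e2) = b1 || b2.
Proof.
move=> h1 h2; rewrite (eval_not (eval_and (eval_not h1) (eval_not h2))).
by rewrite negb_and !negbK.
Qed.

Lemma run_if e c1 c2 (b : bool) : eval s e = b ->
  run (LIf e c1 c2) s = if b then run c1 s else run c2 s.
Proof. by move=> /= ->; case: b. Qed.

End Eval.

(** The loop rule with the set [D] of elements already processed in place of a counter. The new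
    counter value [j] is arbitrary, so [Inv] must not depend on it. *)
Lemma run_for_set (Inv : {set X} -> state -> Prop) i c s :
  wf (LFor i c) -> regs s 1 = n -> Inv set0 (set_reg i 0 s) ->
  (forall (D : {set X}) x s' j, x \notin D -> regs s' i = rk x ->
     (forall r, ~~ writes r (LFor i c) -> regs s' r = regs s r) ->
     (~~ writes_mem c -> mem s' = mem s) ->
     Inv D s' -> Inv (x |: D) (set_reg i j (run c s'))) ->
  Inv setT (run (LFor i c) s).
Proof.
move=> wc s1 I0 IS.
pose J j s' := [/\ forall r, ~~ writes r (LFor i c) -> regs s' r = regs s r,
  ~~ writes_mem c -> mem s' = mem s & Inv [set x | rk x < j] s'].
have [||_ _] := @run_for_ind J i c s wc.
- rewrite /J (_ : [set x | rk x < 0] = set0); last first.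
    by apply/setP => x; rewrite !inE.
  split=> //= r; rewrite negb_or /update => /andP[/negPf -> //].
- move=> j s' jn s'1 s'i [fr fm Is']; split.
  + move=> r wr; move: (wr) => /=; rewrite negb_or /update => /andP[/negPf -> h].
    by rewrite run_reg_frame // fr.
  + by move=> wm; rewrite /= run_mem_frame ?fm.
  + have [x xj] : exists x, rk x = j by apply: rk_surj; rewrite -s1.
    have -> : [set x | rk x < j.+1] = x |: [set x | rk x < j].
      apply/setP => z; rewrite !inE ltnS leq_eqVlt -xj.
      by rewrite (inj_eq rk_inj).
    by apply: IS => //; rewrite ?inE ?xj ?ltnn.
rewrite (_ : [set x | rk x < regs s 1] = setT) //.
by apply/setP => x; rewrite !inE s1 rk_lt.
Qed.

Lemma card_setIU1 (A D : {set X}) x :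
  x \notin D -> #|A :&: (x |: D)| = (x \in A) + #|A :&: D|.
Proof.
move=> xD; case: (boolP (x \in A)) => xA.
  have -> : A :&: (x |: D) = x |: (A :&: D).
    by apply/setP => z; rewrite !inE; case: eqP => [->|]; rewrite ?xA.
  by rewrite cardsU1 inE (negPf xD) andbF.
congr #|pred_of_set _|; apply/setP => z; rewrite !inE.
by case: eqP => [->|] //; rewrite (negPf xA).
Qed.

Lemma run_seq c1 c2 s : run (LSeq c1 c2) s = run c2 (run c1 s).
Proof. by []. Qed.

Definition radius_env (x y : X) (s : state) : Prop :=
  [/\ env s, regs s 3 = rk x & regs s 4 = rk y].

Lemma radius_env_frame x y s s' : radius_env x y s -> mem s' = mem s ->
  (forall r, r \in [:: 1; 2; 3; 4] -> regs s' r = regs s r) ->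
  radius_env x y s'.
Proof.
move=> [es h3 h4] m fr; split; rewrite ?fr //.
by apply: env_frame es _ _ m; rewrite fr.
Qed.

Lemma eval_near s a e1 e2 x y u v : radius_env x y s ->
  eval s e1 = rk u -> eval s e2 = rk v ->
  eval s (eNear a e1 e2) = (dist u v <= a%:R * dist x y)%R.
Proof. by move=> [es h3 h4] h1 h2; apply: eval_dist_le. Qed.

Lemma run_set_arr s a e1 e2 u : env s -> eval s e1 = rk u ->
  run (LMem (eAddr a e1) e2) s =
  set_mem (size input + a * n + rk u) (eval s e2) s.
Proof. by move=> es eu; rewrite -(eval_addr es a eu). Qed.

Lemma radius_env_set_reg x y s i v : i \notin [:: 1; 2; 3; 4] ->
  radius_env x y s -> radius_env x y (set_reg i v s).
Proof.
move=> ih rs; apply: radius_env_frame rs _ _ => // r rh.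
rewrite /= /update; case: eqP => // ri.
by rewrite -ri rh in ih.
Qed.

Lemma radius_env_set_arr x y s a u v :
  radius_env x y s ->
  radius_env x y (set_mem (size input + a * n + rk u) v s).
Proof. by move=> [es h3 h4]; split=> //; apply: env_set_arr. Qed.

Section GreedyStep.

Variables x y : X.
Let R := dist x y.
Let R_ge0 : (0 <= R)%R := dist_ge0 x y.

Notation G := (ball (2 * R)%R).
Notation E := (ball (4 * R)%R).

Lemma inspect_spec v (U : {set X}) s :
  radius_env x y s -> regs s 6 = rk v ->
  (forall u, arr s 0 u = (u \in U)) ->
  let s' := run inspect s in
  [/\ regs s' 8 = #|G v :\: U|, regs s' 9 = #|G v|
    & regs s' 10 = 0 /\ {in L, forall c, ~~ (dist v c <= R)%R} \/
      exists2 c, regs s' 10 = (rk c).+1 & serves R c v].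
Proof.
move=> cs s6 cov; rewrite /inspect !run_seq.
set s0 := run _ (run _ (run _ s)).
(* The preference of [serves] for the point itself is missing here; only the test after the loop
   establishes it. *)
pose Inv (D : {set X}) s' :=
  [/\ regs s' 8 = #|(G v :\: U) :&: D|, regs s' 9 = #|G v :&: D|
    & regs s' 10 = 0 /\ {in L :&: D, forall c, ~~ (dist v c <= R)%R} \/
      exists2 c, regs s' 10 = (rk c).+1 & (c \in L) && (dist v c <= R)%R].
have : Inv setT (run (LFor 7 inspect_body) s0).
  apply: run_for_set => //; first by case: cs => [[]].
    split=> /=; rewrite ?setI0 ?cards0 //; left; split=> // c.
    by rewrite in_set0.
  move=> D u s' j uD s'7 fr fm [i8 i9 i10].
  have ms' : mem s' = mem s by rewrite fm.
  have s'6 : eval s' (Reg 6) = rk v by rewrite /= fr.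
  change (eval s' (Reg 7) = rk u) in s'7.
  have cs' : radius_env x y s'.
    by apply: radius_env_frame cs ms' _ => r; rewrite !inE => /or4P[] /eqP ->; rewrite fr.
  have [es' _ _] := cs'.
  rewrite /inspect_body run_seq.
  have tA := eval_and (eval_point es' s'7) (eval_near 2 cs' s'6 s'7).
  have tN : eval s' (eNot (eArr 0 (Reg 7))) = (u \notin U).
    by apply: eval_not; rewrite (eval_arr es' 0 s'7) (arr_frame _ _ ms').
  set s1 := run (LIf _ (LSeq _ _) _) s'.
  have f1 r : r != 8 -> r != 9 -> regs s1 r = regs s' r.
    by move=> r8 r9; rewrite run_reg_frame //= (negPf r8) (negPf r9).
  have m1 : mem s1 = mem s' by rewrite run_mem_frame.
  have cs1 : radius_env x y s1.
    by apply: radius_env_frame cs' m1 _ => r; rewrite !inE => /or4P[] /eqP ->; rewrite f1.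
  have [es1 _ _] := cs1.
  have s17 : eval s1 (Reg 7) = rk u by rewrite /= f1.
  have s16 : eval s1 (Reg 6) = rk v by rewrite /= f1.
  have s189 : regs s1 8 = (u \in G v :\: U) + regs s' 8 /\
              regs s1 9 = (u \in G v) + regs s' 9.
    rewrite /s1 (run_if _ _ tA) in_setD inE -/R.
    case: (_ && _); rewrite ?andbF ?andbT //.
    rewrite run_seq.
    have tN' : eval (run (LReg 9 (eSucc 9)) s') (eNot (eArr 0 (Reg 7))) = (u \notin U) := tN.
    rewrite (run_if _ _ tN').
    by case: (u \notin U) => /=; rewrite /update /= ?addn1.
  have tB := eval_and (eval_loc es1 s17) (eval_near 1 cs1 s16 s17).
  rewrite (run_if _ _ tB) mul1r -/R.
  case: s189 => s18 s19; split=> /=; rewrite /update /=.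
  - rewrite card_setIU1 // -i8 -s18.
    by case: (_ && _).
  - rewrite card_setIU1 // -i9 -s19.
    by case: (_ && _).
  case: (boolP (_ && _)) => [h|h]; first by right; exists u; rewrite // f1 // -s'7 /= addn1.
  rewrite f1 //; case: i10 => [[-> hc]|hc]; [left; split=> // c|by right].
  rewrite !inE andb_orr => /orP[/andP[cL /eqP cu]|cLD]; last by apply: hc; rewrite inE.
  by move: h; rewrite -cu cL.
set s1 := run (LFor _ _) _ => -[i8 i9 i10].
have f1 r : r \in [:: 1; 2; 3; 4; 6] -> regs s1 r = regs s r.
  by rewrite !inE => h; rewrite run_reg_frame /s0 /= /update; do 4?case/orP: h => [/eqP->//|h]; rewrite (eqP h).
have m1 : mem s1 = mem s by rewrite run_mem_frame.
have es1 : env s1 by case: cs => es _ _; apply: env_frame es _ _ m1; rewrite f1.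
have s16 : eval s1 (Reg 6) = rk v by rewrite /= f1.
rewrite (run_if _ _ (eval_loc es1 s16)).
rewrite !setIT in i8 i9 i10.
case: ifP => vL; split=> //=; rewrite /update /=.
- by right; exists v; rewrite ?f1 // ?s6 ?addn1 //; split=> //; rewrite dist_xx.
- case: i10 => [i10|[c c10 /andP[cL dc]]]; [by left|right].
  by exists c => //; split=> //; rewrite vL.
Qed.

Lemma radius_env_run s c : ~~ writes_mem c ->
  all (fun r => ~~ writes r c) [:: 1; 2; 3; 4] ->
  radius_env x y s -> radius_env x y (run c s).
Proof.
move=> wm /allP wr rs; apply: radius_env_frame rs _ _; first exact: run_mem_frame.
by move=> r /wr; apply: run_reg_frame.
Qed.

Lemma select_spec (U : {set X}) s :
  radius_env x y s -> (forall u, arr s 0 u = (u \in U)) ->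
  let s' := run select s in
  (forall w, candidate R U w -> #|G w :\: U| <= regs s' 11) /\
  (0 < regs s' 11 -> exists v, exists c,
    [/\ regs s' 12 = rk v, regs s' 13 = rk c, candidate R U v, serves R c v
      & regs s' 11 = #|G v :\: U|]).
Proof.
move=> rs cov; rewrite /select run_seq; set s0 := run (LReg _ _) s.
set c := LSeq inspect _.
pose Inv (D : {set X}) s' :=
  (forall w, w \in D -> candidate R U w -> #|G w :\: U| <= regs s' 11) /\
  (0 < regs s' 11 -> exists v, exists c,
    [/\ regs s' 12 = rk v, regs s' 13 = rk c, candidate R U v, serves R c v
      & regs s' 11 = #|G v :\: U|]).
suff [h1 h2] : Inv setT (run (LFor 6 c) s0) by split=> // w; apply: h1; rewrite inE.
apply: run_for_set => //; first by case: rs => [[]].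
  by split=> // w; rewrite inE.
move=> D v s' j vD s'6 fr fm [i1 i2].
have ms' : mem s' = mem s by rewrite fm.
have rs' : radius_env x y s'.
  by apply: radius_env_frame rs ms' _ => r; rewrite !inE => /or4P[] /eqP ->; rewrite fr.
have [s18 s19 s110] : [/\ _, _ & _] := inspect_spec rs' s'6 (fun u => etrans (arr_frame 0 u ms') (cov u)).
rewrite run_seq; set s1 := run inspect s' in s18 s19 s110 *.
have f1 r : r \in [:: 6; 11; 12; 13] -> regs s1 r = regs s' r.
  by rewrite !inE => /or4P[] /eqP ->; rewrite run_reg_frame.
have rs1 : radius_env x y s1 by apply: radius_env_run.
have m1 : mem s1 = mem s' by rewrite run_mem_frame.
have [es1 _ _] := rs1.
have s16 : eval s1 (Reg 6) = rk v by rewrite /= f1.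
have tU : eval s1 (eArr 0 (Reg 6)) = (v \in U).
  by rewrite (eval_arr es1 0 s16) (arr_frame _ _ m1) (arr_frame _ _ ms').
have tB := eval_and (eval_and (eval_and (eval_and (eval_point es1 s16) (eval_not tU))
  (eval_lt_expr s1 (Const 0) (Reg 10))) (eval_le_expr s1 (Mem (Const 2)) (Reg 9)))
  (eval_lt_expr s1 (Reg 11) (Reg 8)).
rewrite (run_if _ _ tB) [eval s1 (Mem _)]/= (env_mem2 es1).
rewrite [eval s1 (Reg 9)]/= s19 [eval s1 (Reg 8)]/= s18.
rewrite [eval s1 (Reg 11)]/= f1 // [eval s1 (Const 0)]/= [eval s1 (Reg 10)]/=.
rewrite -!andbA.
(* The existence of a location within [R] is what a nonzero register 10 records. *)
have candE : candidate R U v =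
    [&& v \in P, v \notin U, 0 < regs s1 10 & lower_bound I <= #|G v|].
  rewrite /candidate; congr [&& _, _ & _]; rewrite andbC; congr (_ && _).
  case: s110 => [[-> h]|[c' -> [cL dc _]]].
    by apply/existsP => -[c' /andP[/h /negPf ->]].
  by apply/existsP; exists c'; rewrite cL.
have -> : [&& v \in P, v \notin U, 0 < regs s1 10, lower_bound I <= #|G v|
   & regs s' 11 < #|G v :\: U|] = candidate R U v && (regs s' 11 < #|G v :\: U|).
  by rewrite candE -!andbA.
case: ifP => [/andP[cv lt]|h].
  split.
    move=> w /setU1P[->|wD cw]; rewrite /= /update /= s18 //.
    exact: leq_trans (i1 w wD cw) (ltnW lt).
  move=> _; exists v.
  case: s110 => [[h0 _]|[c' c'10 c's]]; first by move: cv; rewrite candE h0 /= !andbF.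
  by exists c'; rewrite /= /update /= c'10 subn1.
rewrite [run _ _]/=; split; rewrite /= /update /=; last by rewrite !f1.
rewrite f1 // => w /setU1P[->|wD] cw; last exact: i1.
by move: h; rewrite cw /= ltnNge => /negbFE.
Qed.

Definition greedy_state (p : nat) (U C : {set X}) (f : X -> X) (s : state) :
    Prop :=
  [/\ radius_env x y s, regs s 14 = p, forall u, arr s 0 u = (u \in U),
      forall u, arr s 1 u = (u \in C) & forall u, arr s 2 u = rk (f u)].

Lemma pick_spec p U C f s v c :
  greedy_state p U C f s -> regs s 12 = rk v -> regs s 13 = rk c ->
  let s' := run pick s in
  greedy_state p.+1 (U :|: E v) (c |: C)
    (fun u => if u \in G v :|: (E v :\: U) then c else f u) s' /\
  (forall a u, 3 <= a -> arr s' a u = arr s a u).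
Proof.
move=> [rs s14 a0 a1 a2] s12 s13; rewrite /pick !run_seq.
set s1 := run (LReg _ _) s.
have rs1 : radius_env x y s1 by apply: radius_env_set_reg.
have [es1 _ _] := rs1.
have s113 : eval s1 (Reg 13) = rk c by rewrite /= /update.
rewrite (run_set_arr 1 _ es1 s113); set s2 := set_mem _ _ _.
have rs2 : radius_env x y s2 by apply: radius_env_set_arr.
pose V := G v :|: (E v :\: U).
pose Inv (D : {set X}) s' := [/\ radius_env x y s',
  forall u, arr s' 0 u = (u \in U :|: (V :&: D)),
  forall u, arr s' 1 u = (u \in c |: C),
  forall u, arr s' 2 u = rk (if u \in V :&: D then c else f u) &
  forall a u, 3 <= a -> arr s' a u = arr s a u].
have : Inv setT (run (LFor 7 pick_body) s2).
  apply: run_for_set => //; first by case: rs2 => [[]].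
    split.
    + exact: radius_env_set_reg.
    + by move=> u; rewrite setI0 setU0 -a0 [LHS]arr_set_arr.
    + move=> u; rewrite [LHS]arr_set_arr /= in_setU1 eq_sym.
      by case: eqP => //= _; apply: a1.
    + by move=> u; rewrite setI0 in_set0 [LHS]arr_set_arr /=; apply: a2.
    + by move=> a u a3; rewrite [LHS]arr_set_arr; case: a a3 => [|[|a]].
  move=> D u s' j uD s'7 fr _ [rs' i0 i1 i2 i3].
  have [es' _ _] := rs'.
  have s'12 : eval s' (Reg 12) = rk v by rewrite /= fr.
  have s'13 : eval s' (Reg 13) = rk c by rewrite /= fr.
  change (eval s' (Reg 7) = rk u) in s'7.
  (* The loop reads the array it modifies, but the cell of [u] still shows the old [U], because [u]
     has not been processed. *)
  have tU : eval s' (eArr 0 (Reg 7)) = (u \in U).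
    by rewrite (eval_arr es' 0 s'7) i0 !inE (negPf uD) andbF orbF.
  have := eval_and (eval_point es' s'7) (eval_or (eval_near 2 rs' s'12 s'7)
    (eval_and (eval_not tU) (eval_near 4 rs' s'12 s'7))).
  have -> : (u \in P) && ((dist v u <= 2%:R * dist x y)%R ||
      (u \notin U) && (dist v u <= 4%:R * dist x y)%R) = (u \in V).
    by rewrite !inE; case: (u \in P); rewrite ?andbF.
  move=> tV; rewrite /pick_body (run_if _ _ tV).
  case: (boolP (u \in V)) => uV.
    rewrite run_seq (run_set_arr 0 _ es' s'7).
    rewrite (@run_set_arr _ 2 (Reg 7) _ u) //; last exact: env_set_arr.
    split.
    + by apply: radius_env_set_reg => //; do 2!apply: radius_env_set_arr.
    + move=> z; rewrite [LHS]arr_set_arr arr_set_arr /= i0 !inE eq_sym.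
      by case: eqP => [->|//]; move: uV; rewrite !inE => ->; rewrite orbT.
    + by move=> z; rewrite [LHS]arr_set_arr arr_set_arr /= i1.
    + move=> z; rewrite [LHS]arr_set_arr arr_set_arr /= i2 !in_setI in_setU1 eq_sym.
      by case: eqP => [->|//]; rewrite uV.
    + by move=> a z a3; rewrite [LHS]arr_set_arr arr_set_arr -i3 //; case: a a3 => [|[|[|a]]].
  have VD : V :&: (u |: D) = V :&: D.
    apply/setP => z; rewrite !in_setI in_setU1; case: eqP => [->|//].
    by rewrite (negPf uV).
  split; rewrite ?VD //; exact: radius_env_set_reg.
set s3 := run (LFor _ _) _; move=> [rs3 i0 i1 i2 i3].
rewrite !setIT in i0 i2; split=> //; split=> //.
- by rewrite run_reg_frame //= /update /= s14 addn1.
- move=> u; rewrite i0; congr nat_of_bool.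
  rewrite !in_setU in_setD; case: (boolP (u \in U)) => //= _.
  by case: (boolP (u \in G v)) => //= /(subsetP (ball_sub R_ge0 v)).
Qed.

(** Each pick covers at least the picked point, so [n] rounds suffice: either the greedy algorithm
    gets stuck earlier, or the whole space is covered and no candidate is left. *)
Lemma greedy_spec s : radius_env x y s ->
  let s' := run greedy s in
  (forall a u, 3 <= a -> arr s' a u = arr s a u) /\
  exists p U C f,
  [/\ greedy_state p U C f s', clustering R p U C f, cover_bound R p U
    & p = max_centers I \/ forall v, ~~ candidate R U v].
Proof.
move=> rs; rewrite /greedy run_seq; set s0 := run (LReg _ _) s.
have rs0 : radius_env x y s0 by apply: radius_env_set_reg.
rewrite run_seq; set s1 := run (LFor 7 clear_body) s0.
pose Inv (D : {set X}) s' := [/\ radius_env x y s',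
  forall u, u \in D -> [/\ arr s' 0 u = 0, arr s' 1 u = 0 & arr s' 2 u = rk u]
  & forall a u, 3 <= a -> arr s' a u = arr s a u].
have [rs1 c1 c2] : Inv setT s1.
  apply: run_for_set => //; first by case: rs0 => [[]].
    by split=> // u; rewrite inE.
  move=> D u s' j uD s'7 fr _ [rs' i1 i2]; have [es' _ _] := rs'.
  rewrite /clear_body !run_seq.
  rewrite (@run_set_arr _ 0 (Reg 7) _ u) //; set t1 := set_mem _ _ _.
  have et1 : env t1 by apply: env_set_arr.
  rewrite (@run_set_arr _ 1 (Reg 7) _ u) //; set t2 := set_mem _ _ _.
  rewrite (@run_set_arr _ 2 (Reg 7) _ u) //; last exact: env_set_arr.
  have aE a z : arr (set_mem (size input + 2 * n + rk u) (eval t2 (Reg 7)) t2) a z =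
     if u == z then nth (arr s' a z) [:: 0; 0; rk u] a else arr s' a z.
    rewrite arr_set_arr /t2 arr_set_arr /t1 arr_set_arr.
    case: (u == z); last by rewrite !andbF.
    by case: a => [|[|[|a]]] //=; rewrite nth_nil.
  split.
  + by apply: radius_env_set_reg => //; do 3!apply: radius_env_set_arr.
  + move=> z; rewrite in_setU1 => zD.
    by split; rewrite [LHS](aE _ z) eq_sym; case: eqP zD => [->|_ /i1[]].
  + move=> a z a3; rewrite [LHS](aE a z) -i2 //.
    by case: eqP => // _; case: a a3 => [|[|[|a]]] //= _; rewrite nth_nil.
pose Inv2 (D : {set X}) s' :=
  (forall a u, 3 <= a -> arr s' a u = arr s a u) /\
  exists p U C f,
  [/\ greedy_state p U C f s', clustering R p U C f, cover_bound R p U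
    & #|D| <= #|U| \/ (p = max_centers I \/ forall v, ~~ candidate R U v)].
suff [H1 [p [U [C [f [H2 H3 H4 H5]]]]]] : Inv2 setT (run (LFor 5 greedy_body) s1).
  split=> //; exists p, U, C, f; split=> //.
  case: H5 => [|//]; rewrite cardsT => nU; right=> v.
  have -> : U = setT by apply/eqP; rewrite eqEcard subsetT cardsT.
  by rewrite /candidate in_setT andbF.
apply: run_for_set => //; first by case: rs1 => [[]].
  split=> //; exists 0, set0, set0, id; split.
  + split=> //.
    * by rewrite /= /update /= run_reg_frame.
    * by move=> u; rewrite inE; case: (c1 u (in_setT _)).
    * by move=> u; rewrite inE; case: (c1 u (in_setT _)).
    * by move=> u; case: (c1 u (in_setT _)).
  + exact: clustering0.
  + exact: cover_bound0.
  + by left; rewrite cards0.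
move=> D u s' j uD s'5 fr _ [i1 [p [U [C [f [gs cl cb st]]]]]].
have [rs' s'14 a0 a1 a2] := gs.
have [sel1 sel2] := select_spec rs' a0.
rewrite /greedy_body run_seq; set t := run select s' in sel1 sel2 *.
have mt : mem t = mem s' by rewrite run_mem_frame.
have gt : greedy_state p U C f t.
  split; rewrite -?s'14.
  + exact: radius_env_run.
  + by rewrite run_reg_frame.
  + by move=> z; rewrite (arr_frame _ _ mt).
  + by move=> z; rewrite (arr_frame _ _ mt).
  + by move=> z; rewrite (arr_frame _ _ mt).
have [[et _ _] t14 _ _ _] := gt.
have tB := eval_and (eval_lt_expr t (Const 0) (Reg 11))
                    (eval_lt_expr t (Reg 14) (Mem (Const 1))).
rewrite (run_if _ _ tB) [eval t (Mem _)]/= (env_mem1 et).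
rewrite [eval t (Reg 14)]/= t14 [eval t (Reg 11)]/= [eval t (Const 0)]/=.
have set5 q U' C' f' t' : greedy_state q U' C' f' t' ->
    greedy_state q U' C' f' (set_reg 5 j t').
  by move=> [? ? ? ? ?]; split=> //; apply: radius_env_set_reg.
case: ifP => [/andP[t11 pk]|h].
  have [v [c [t12 t13 cv sv vE]]] := sel2 t11.
  have [gs' fr3] := pick_spec gt t12 t13.
  split.
    by move=> a z a3; rewrite -i1 // -(arr_frame a z mt) -fr3.
  exists p.+1, (U :|: E v), (c |: C); eexists; split.
  + by apply: set5 gs'.
  + exact: clustering_step cl pk cv sv _.
  + by apply: cover_bound_step => // w cw; rewrite -vE; apply: sel1.
  case: st => [DU|[pk'|noc]]; last by rewrite (negPf (noc v)) in cv.
    left; rewrite cardsU1 uD add1n.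
    apply: leq_ltn_trans DU (proper_card _).
    rewrite properE subsetUl /=; apply/subsetPn; exists v.
      case/and4P: cv => vP _ _ _.
      by rewrite in_setU inE vP dist_xx mulr_ge0 ?orbT.
    by case/and4P: cv.
  by rewrite pk' ltnn in pk.
split; first by move=> a z a3; rewrite -i1 // -(arr_frame a z mt).
exists p, U, C, f; split=> //.
(* No pick although [p < k] means that register 11 is 0; a candidate [w] would belong to
   [G w :\: U], contradicting this. *)
right; case: (eqVneq p (max_centers I)) => [|pk]; [by left | right=> w].
have pk' : p < max_centers I.
  by case: cl => _ _ /andP[_ ple] _ _; rewrite ltn_neqAle pk.
move: h; rewrite pk' andbT => /negbT; rewrite -leqNgt leqn0 => /eqP t110.
apply/negP => cw; have := sel1 _ cw; rewrite t110 leqn0 cards_eq0 => /eqP Gw.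
case/and4P: cw => wP wU _ _.
suff : w \in G w :\: U by rewrite Gw inE.
by rewrite in_setD wU inE wP dist_xx mulr_ge0.
Qed.

End GreedyStep.

(** * Saved solutions and the search over all radii *)

Definition holds (s : state) (S : solution X) : Prop :=
  forall u, [/\ arr s 3 u = (u \in centers S), arr s 4 u = (u \in outliers S)
              & arr s 5 u = rk (assignment S u)].

Definition found (s : state) (x y : X) : Prop :=
  [/\ regs s 15 = 1, regs s 16 = rk x, regs s 17 = rk y
    & exists2 S : solution X, holds s S &
      [/\ feasible S, (objective S <= 5 * dist x y)%R
        & P = L -> (objective S <= 4 * dist x y)%R]].

Lemma found_frame s s' x y : {in [:: 15; 16; 17], regs s' =1 regs s} ->
  (forall a u, 3 <= a -> arr s' a u = arr s a u) -> found s x y -> found s' x y.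
Proof.
move=> fr fa [h1 h2 h3 [S hS gS]]; split; rewrite ?fr //.
by exists S => // u; rewrite !fa.
Qed.

Lemma eval_uncovered s u (U : {set X}) : env s -> regs s 7 = rk u ->
  arr s 0 u = (u \in U) -> eval s eUncovered = (u \in P :\: U).
Proof.
move=> es s7 a0; change (eval s (Reg 7) = rk u) in s7.
have tU : eval s (eArr 0 (Reg 7)) = (u \in U) by rewrite (eval_arr es 0 s7).
by rewrite in_setD andbC; apply: eval_and (eval_point es s7) (eval_not tU).
Qed.

Lemma count_spec s (U : {set X}) : env s ->
  (forall u, arr s 0 u = (u \in U)) ->
  regs (run count_uncovered s) 18 = #|P :\: U|.
Proof.
move=> es a0; rewrite /count_uncovered run_seq; set s0 := run (LReg _ _) s.
set c := LIf _ _ _.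
pose Inv (D : {set X}) s' := regs s' 18 = #|(P :\: U) :&: D|.
suff : Inv setT (run (LFor 7 c) s0) by rewrite /Inv setIT.
apply: run_for_set => //; first by case: es.
  by rewrite /Inv setI0 cards0.
move=> D u s' j uD s'7 fr fm i18.
have ms' : mem s' = mem s by rewrite fm.
have es' : env s' by apply: env_frame es _ _ ms'; rewrite fr.
have tU := eval_uncovered es' s'7 (etrans (arr_frame 0 u ms') (a0 u)).
rewrite /Inv card_setIU1 // -i18 (run_if _ _ tU).
by case: (u \in _); rewrite /= /update //= addn1.
Qed.

Lemma save_spec s x y (U C : {set X}) f :
  env s -> regs s 3 = rk x -> regs s 4 = rk y ->
  (forall u, [/\ arr s 0 u = (u \in U), arr s 1 u = (u \in C)
               & arr s 2 u = rk (f u)]) ->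
  let s' := run save s in
  [/\ env s', regs s' 15 = 1, regs s' 16 = rk x, regs s' 17 = rk y
    & holds s' (Solution C (P :\: U) [ffun u => f u])].
Proof.
move=> es s3 s4 aa; rewrite /save !run_seq; set s0 := run _ (run _ (run _ s)).
pose Inv (D : {set X}) s' := [/\ env s',
   forall a u, a < 3 -> arr s' a u = arr s a u &
   forall u, u \in D -> [/\ arr s' 3 u = (u \in C),
      arr s' 4 u = (u \in P :\: U) & arr s' 5 u = rk (f u)]].
have : Inv setT (run (LFor 7 save_body) s0).
  apply: run_for_set => //; first by case: es.
    by split=> // u; rewrite inE.
  move=> D u s' j uD s'7 fr _ [es' i1 i2].
  rewrite /save_body !run_seq.
  rewrite (@run_set_arr _ 3 (Reg 7) _ u) // (eval_arr es' 1 (s'7 : eval s' (Reg 7) = _)) i1 //.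
  have [_ -> _] := aa u.
  set t1 := set_mem _ _ s'; have e1 : env t1 by apply: env_set_arr.
  rewrite (@run_set_arr _ 4 (Reg 7) _ u) // [eval _ (Const 0)]/=.
  set t2 := set_mem _ _ t1; have e2 : env t2 by apply: env_set_arr.
  have v2 : eval t2 (eArr 2 (Reg 7)) = rk (f u).
    rewrite (eval_arr e2 2 (s'7 : eval t2 (Reg 7) = _)).
    by rewrite /t2 arr_set_arr /t1 arr_set_arr /= i1 //; have [] := aa u.
  rewrite (@run_set_arr _ 5 (Reg 7) _ u) // v2.
  set t3 := set_mem _ _ t2; have e3 : env t3 by apply: env_set_arr.
  have a3 a z : arr t3 a z = if (u == z) && (3 <= a)
     then nth (arr s' a z) [:: 0; 0; 0; u \in C : nat; 0; rk (f u)] a else arr s' a z.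
    rewrite /t3 arr_set_arr /t2 arr_set_arr /t1 arr_set_arr.
    case: (u == z); last by rewrite !andbF.
    by case: a => [|[|[|[|[|[|a]]]]]] //=; rewrite nth_nil.
  have tU : eval t3 eUncovered = (u \in P :\: U).
    by apply: eval_uncovered => //; rewrite a3 andbF i1 //; have [] := aa u.
  have -> : run (LIf eUncovered (LMem (eAddr 4 (Reg 7)) (Const 1)) LSkip) t3 =
     if u \in P :\: U then set_mem (size input + 4 * n + rk u) 1 t3 else t3.
    rewrite (run_if _ _ tU); case: (u \in _) => //.
    by rewrite (@run_set_arr _ 4 (Reg 7) _ u).
  set t4 := if _ then _ else _.
  have e4 : env t4 by rewrite /t4; case: ifP => // _; apply: env_set_arr.
  have a4 a z : arr t4 a z = if (u == z) && (3 <= a)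
     then nth (arr s' a z) [:: 0; 0; 0; u \in C : nat; u \in P :\: U : nat; rk (f u)] a
     else arr s' a z.
    rewrite /t4; case: (u \in P :\: U); last exact: a3.
    rewrite arr_set_arr a3; case: (u == z); last by rewrite !andbF.
    by case: a => [|[|[|[|[|[|a]]]]]] //=; rewrite nth_nil.
  split.
  + exact: env_set_reg.
  + move=> a z a2; rewrite [LHS](a4 a z) -i1 //.
    by rewrite [2 < a]leqNgt a2 andbF.
  + move=> z; rewrite in_setU1 => zD.
    by split; rewrite [LHS](a4 _ z) eq_sym; case: eqP zD => [->|_ /i2[]].
set s1 := run (LFor _ _) _; move=> [es1 _ h]; split=> //.
- by rewrite run_reg_frame.
- by rewrite run_reg_frame.
- by rewrite run_reg_frame.
- by move=> u; rewrite ffunE; apply: h; rewrite inE.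
Qed.

(** The greedy run and the count touch only the arrays 0 to 2, so a failed trial preserves the saved
    solution. By [few_uncovered], a trial at a radius that bounds the value of a feasible solution
    cannot fail. *)
Lemma trial_spec x y s : radius_env x y s -> 
  let s' := run trial s in
  [/\ env s',
      (exists2 S : solution X, feasible S & (objective S <= dist x y)%R) ->
        found s' x y
    & found s' x y \/ {in [:: 15; 16; 17], regs s' =1 regs s} /\
        (forall a u, 3 <= a -> arr s' a u = arr s a u)].
Proof.
move=> rs; have [a3 [p [U [C [f [gs cl cb st]]]]]] := greedy_spec rs.
rewrite /trial !run_seq; set s1 := run greedy s in a3 gs *.
have [rs1 s1p a0 a1 a2] := gs; have [es1 s13 s14] := rs1.
have c18 := count_spec es1 a0.
set s2 := run count_uncovered s1 in c18 *.
have m2 : mem s2 = mem s1 by rewrite run_mem_frame.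
have [es2 s23 s24] : radius_env x y s2 by apply: radius_env_run.
have tB := eval_le_expr s2 (Reg 18) (Mem (Const 3)).
rewrite (run_if _ _ tB) [eval _ (Reg 18)]/= c18 [eval _ (Mem _)]/= (env_mem3 es2).
case: ifP => h.
  have [|es3 h1 h2 h3 h4] := save_spec (U := U) (C := C) (f := f) es2 s23 s24.
    by move=> u; rewrite !(arr_frame _ _ m2).
  have F : found (run save s2) x y.
    split=> //; exists (Solution C (P :\: U) [ffun u => f u]); first exact: h4.
    exact: (clustering_feasible (dist_ge0 x y) cl h).
  by split=> //; left.
split=> //=.
  move=> [S fS oS]; have UP : U \subset P by case: cl.
  by have := few_uncovered (dist_ge0 x y) fS oS UP cb st; rewrite h.
right; split.
  by move=> r; rewrite !inE => /or3P[] /eqP ->; rewrite /s2 /s1 !run_reg_frame.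
by move=> a u a3'; rewrite (arr_frame _ _ m2) a3.
Qed.

Definition search_state (s : state) : Prop :=
  env s /\ (regs s 15 = 0 \/ exists x y, found s x y).

Definition found_within (r : rat) (s : state) : Prop :=
  exists x y, found s x y /\ (dist x y <= r)%R.

(** The best radius never increases: a trial is made only at a radius below it, and a skipped pair
    is already matched by the saved one. *)
Lemma search_body_spec x y s :
  radius_env x y s -> search_state s ->
  let s' := run search_body s in
  [/\ search_state s', forall r, found_within r s -> found_within r s'
    & (exists2 S : solution X, feasible S & (objective S <= dist x y)%R) ->
      found_within (dist x y) s'].
Proof.
move=> rs [es fs]; rewrite /search_body.
set b := eOr _ _.
suff [better [bE bT bF]] : exists better : bool, [/\ eval s b = better,
    better -> forall r, found_within r s -> (dist x y <= r)%R
  & ~~ better -> found_within (dist x y) s].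
  rewrite (run_if _ _ bE); case: better bT bF {bE} => [bT _|_ bF]; last first.
    by split=> // _; apply: bF.
  have [es' h1 h2] := trial_spec rs; set s' := run trial s in es' h1 h2 *.
  split.
  - split=> //; case: h2 => [F|[fr fa]]; first by right; exists x, y.
    case: fs => [s15|[x' [y' F]]]; first by left; rewrite fr.
    by right; exists x', y'; apply: found_frame F.
  - move=> r Fr; case: h2 => [F|[fr fa]].
      by exists x, y; split=> //; apply: bT.
    case: Fr => x' [y' [F xyr]]; exists x', y'; split=> //.
    exact: found_frame F.
  - by move=> /h1 F; exists x, y.
case: fs => [s15|[x' [y' F]]].
  exists true; split=> //; first by rewrite /b /= s15.
  by move=> _ r [x' [y' [[]]]]; rewrite s15.
have [s15 s16 s17 _] := F; have [_ s3 s4] := rs.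
exists (~~ (dist x' y' <= 1%:R * dist x y)%R); split.
- have t15 : eval s (eNot (Reg 15)) = false by rewrite /= s15.
  by apply: (eval_or t15); apply: eval_not; apply: eval_dist_le.
(* Registers 16 and 17 determine the saved pair, so both descriptions of it agree. *)
- move=> h r [x2 [y2 [[_ t16 t17 _] le]]]; apply: le_trans le.
  move: h; rewrite mul1r -ltNge => /ltW.
  by rewrite (rk_inj (etrans (esym t16) s16)) (rk_inj (etrans (esym t17) s17)).
- by rewrite negbK mul1r => h; exists x', y'.
Qed.

Lemma search_spec s : env s -> regs s 15 = 0 ->
  let s' := run search s in
  search_state s' /\
  forall x y : X, (exists2 S : solution X, feasible S & (objective S <= dist x y)%R) ->
    found_within (dist x y) s'.
Proof.
move=> es s15; pose sat (x y : X) s' :=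
  (exists2 S : solution X, feasible S & (objective S <= dist x y)%R) ->
    found_within (dist x y) s'.
have within_set r i j s' : i \notin [:: 15; 16; 17] -> found_within r s' ->
    found_within r (set_reg i j s').
  move=> ih [x [y [F xyr]]]; exists x, y; split=> //; apply: found_frame F => //.
  by move=> q qh; rewrite /= /update; case: eqP => // qi; rewrite -qi qh in ih.
have state_set i j s' : i \notin [:: 1; 2; 15; 16; 17] -> search_state s' ->
    search_state (set_reg i j s').
  rewrite !inE !negb_or => /and5P[i1 i2 i3 i4 i5] [es' F]; split.
    by apply: env_set_reg => //; rewrite i1.
  case: F => [F|[x [y F]]]; [left | right; exists x, y].
    by rewrite /= /update eq_sym (negPf i3).
  apply: found_frame F => // q; rewrite !inE => qh; rewrite /= /update.
  by case: eqP => // qi; move: qh; rewrite qi (negPf i3) (negPf i4) (negPf i5).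
pose Inv (D : {set X}) s' := search_state s' /\
  forall x y, x \in D -> sat x y s'.
suff [h1 h2] : Inv setT (run (LFor 3 (LFor 4 search_body)) s).
  by split=> // x y; apply: h2; rewrite inE.
apply: run_for_set => //; first by case: es.
  split=> [|x y]; last by rewrite inE.
  by apply: state_set => //; split=> //; left.
move=> D x s' j xD s'3 fr _ [i1 i2]; have [es' _] := i1.
pose Inv2 (D' : {set X}) t := [/\ search_state t,
  forall r, found_within r s' -> found_within r t
  & forall y, y \in D' -> sat x y t].
have [h1 h2 h3] : Inv2 setT (run (LFor 4 search_body) s').
  apply: run_for_set => //; first by case: es'.
    split; first exact: state_set.
    + by move=> r; apply: within_set.
    + by move=> y; rewrite inE.
  move=> D' y t j' yD' t4 frt _ [k1 k2 k3].
  have rt : radius_env x y t.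
    by case: k1 => et _; split=> //; rewrite frt.
  have [m1 m2 m3] := search_body_spec rt k1.
  split; first exact: state_set.
  + by move=> r /k2 /m2; apply: within_set.
  + move=> z; rewrite in_setU1 => zD hS; apply: within_set => //.
    by case/orP: zD => [/eqP zy|zD']; [rewrite zy in hS *; apply: m3 | apply: m2; apply: k3].
split; first exact: state_set.
move=> z y; rewrite in_setU1 => zD hS; apply: within_set => //.
case/orP: zD => [/eqP zx|zD]; last by apply: h2; apply: i2.
by rewrite zx in hS *; apply: h3; rewrite ?inE.
Qed.

(** * Writing the output *)

Lemma mkseq_enum (g : nat -> nat) (f : X -> nat) :
  (forall u, g (rk u) = f u) -> mkseq g n = [seq f u | u <- enum X].
Proof.
move=> gf; apply: (@eq_from_nth _ 0); first by rewrite size_mkseq size_map -cardE.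
move=> i; rewrite size_mkseq => i_n; have [u <-] := rk_surj i_n.
by rewrite nth_mkseq ?rk_lt // nth_enum_map.
Qed.

Lemma mkseq_add (g : nat -> nat) a b :
  mkseq g (a + b) = mkseq g a ++ mkseq (fun i => g (a + i)) b.
Proof.
rewrite /mkseq iotaD map_cat; congr (_ ++ _).
by rewrite add0n -[X in iota X]addn0 iotaDl -map_comp.
Qed.

Lemma mem_set_reg i v s : mem (set_reg i v s) = mem s.
Proof. by []. Qed.

Lemma mem_set_mem i v s a :
  mem (set_mem i v s) a = if a == i then v else mem s a.
Proof. by []. Qed.

Lemma write_output_spec s S : env s -> holds s S ->
  output (run write_output s) = encode_solution S.
Proof.
move=> es hS; rewrite /write_output run_seq; set s0 := run (LReg _ _) s.
have small : n + n + n <= size input.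
  by rewrite size_input; have := leq_pmull n; case: (n) => // m /(_ m.+1 isT); lia.
(* The input is being destroyed, so [env] is not maintained; writing below [size input] leaves the
   arrays intact, and the frame conditions keep registers 1 and 2. *)
pose Inv (D : {set X}) s' := [/\ regs s' 0 = 3 * #|D|,
  forall a u, arr s' a u = arr s a u
  & forall u, u \in D -> [/\ mem s' (rk u) = (u \in centers S),
      mem s' (n + rk u) = (u \in outliers S)
    & mem s' (n + n + rk u) = rk (assignment S u)]].
have : Inv setT (run (LFor 7 write_body) s0).
  apply: run_for_set => //; first by case: es.
    by split=> // [|u]; rewrite ?cards0 ?inE.
  move=> D u s' j uD s'7 fr _ [i0 ia i1].
  have [s1 s2] : regs s' 1 = n /\ regs s' 2 = size input.
    by case: es => h1 h2 _; rewrite !fr.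
  have [v3 v4 v5] := hS u.
  have aset i w s'' a z : i < size input -> arr (set_mem i w s'') a z = arr s'' a z.
    by move=> il; rewrite /arr [mem _]/= /update ifF //; apply/eqP; lia.
  set t := run write_body s'.
  have tE : t = set_mem (n + n + rk u) (rk (assignment S u))
      (set_mem (n + rk u) (u \in outliers S)
        (set_mem (rk u) (u \in centers S) (set_reg 0 (regs s' 0 + 3) s'))).
    rewrite /t /write_body !run_seq.
    have step a e' w s'' i : regs s'' 1 = n -> regs s'' 2 = size input ->
        regs s'' 7 = rk u -> arr s'' a u = w -> eval s'' e' = i ->
        run (LMem e' (eArr a (Reg 7))) s'' = set_mem i w s''.
      by move=> h1 h2 h7 <- <-; rewrite /arr /= h1 h2 h7.
    rewrite [run (LReg _ _) s']/=; set t0 := set_reg 0 _ s'.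
    have a0 a : arr t0 a u = arr s a u by rewrite -ia.
    rewrite (step 3 (Reg 7) (u \in centers S : nat) t0 (rk u)) ?a0 //.
    set t1 := set_mem _ _ t0.
    have a1 a : arr t1 a u = arr s a u by rewrite aset ?a0 //; have := rk_lt u; lia.
    rewrite (step 4 _ (u \in outliers S : nat) t1 (n + rk u)) ?a1 //; last first.
      by rewrite /= /update /= s1 s'7.
    set t2 := set_mem _ _ t1.
    have a2 a : arr t2 a u = arr s a u by rewrite aset ?a1 //; have := rk_lt u; lia.
    rewrite (step 5 _ (rk (assignment S u)) t2 (n + n + rk u)) ?a2 //.
    by rewrite /= /update /= s1 s'7.
  rewrite tE; have ul := rk_lt u; split.
  + by rewrite /= /update /= i0 cardsU1 uD; lia.
  + by move=> a z; rewrite -ia [LHS]aset ?aset //; lia.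
  + move=> z zD; have zl := rk_lt z.
    have zu : z \in D -> rk z <> rk u by move=> zD' /rk_inj zu; rewrite zu (negPf uD) in zD'.
    move: zD; rewrite in_setU1 !mem_set_reg !mem_set_mem mem_set_reg.
    case: eqP => [-> _|_ zD].
      rewrite !eqxx; split.
      * by do 2 (rewrite ifF; last by apply/eqP; lia).
      * by do 1 (rewrite ifF; last by apply/eqP; lia).
      * by [].
    have [w1 w2 w3] := i1 z zD; have {}zu := zu zD.
    by split; do 3 (rewrite ifF; last by apply/eqP; lia).
set s1 := run (LFor _ _) _ => -[r0 _ h].
rewrite /output r0 cardsT (_ : 3 * n = n + (n + n)); last by lia.
rewrite !mkseq_add /encode_solution /encode_set; congr (_ ++ (_ ++ _)).
- by apply: mkseq_enum => u; have [] := h u (in_setT _).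
- by apply: mkseq_enum => u; have [] := h u (in_setT _).
- by apply: mkseq_enum => u; rewrite addnA; have [] := h u (in_setT _).
Qed.

(** This justifies searching the pairwise distances only; [x0] provides the value 0 as
    [dist x0 x0]. *)
Lemma objective_is_distance (S : solution X) (x0 : X) :
  exists x y : X, objective S = dist x y.
Proof.
apply: (big_ind (fun v => exists x y : X, v = dist x y)).
- by exists x0, x0; rewrite dist_xx.
- by move=> a b ha hb; rewrite /Num.max; case: ifP.
- by move=> x _; exists x, (assignment S x).
Qed.

Lemma main_loop_spec s : env s -> regs s 15 = 0 ->
  (exists S : solution X, feasible S) ->
  exists S : solution X,
  [/\ is_approximation 5%R S, P = L -> is_approximation 4%R S
    & output (run main_loop s) = encode_solution S].
Proof.
move=> es s15 [S0 fS0]; rewrite /main_loop run_seq.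
have [[es1 F1] h1] := search_spec es s15; set s1 := run search s in es1 F1 h1 *.
(* In the empty space there is no pair to try and nothing is saved, but every solution has the empty
   encoding and value 0. *)
case: (posnP n) => [n0|n_gt0].
  have noX (x : X) : False by have := rk_lt x; rewrite n0.
  have obj0 (S : solution X) : objective S = 0%R.
    by rewrite /objective big_pred0 // => x; case: (noX x).
  have enum0 : enum X = [::] by apply/eqP; rewrite -size_eq0 -cardE n0.
  have out : output (run write_output s1) = encode_solution S0.
    by apply: write_output_spec => // u; case: (noX u).
  exists S0; rewrite out; split=> //; split=> // v [[S _ <-] _];
    by rewrite !obj0 mulr0.
have [x0 _] := rk_surj n_gt0.
have within (S : solution X) : feasible S -> found_within (objective S) s1.
  move=> fS; have [x [y Sxy]] := objective_is_distance S x0.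
  by rewrite Sxy; apply: h1; exists S => //; rewrite Sxy.
have [x [y [F _]]] := within _ fS0.
have [_ s16 s17 [S hS [fS S5 S4]]] := F.
(* The optimal value is itself a distance that was searched, so the saved radius does not exceed
   it. *)
have best v : is_optimal_value I v -> (dist x y <= v)%R.
  move=> [[S' fS' <-] _]; have [x' [y' [[_ t16 t17 _] le]]] := within _ fS'.
  move: le.
  by rewrite (rk_inj (etrans (esym t16) s16)) (rk_inj (etrans (esym t17) s17)).
exists S; split.
- split=> // v /best xyv; apply: le_trans S5 _.
  by rewrite ler_wpM2l.
- move=> PL; split=> // v /best xyv; apply: le_trans (S4 PL) _.
  by rewrite ler_wpM2l.
- exact: write_output_spec.
Qed.

End Correctness.

(** * Running time in terms of the input size *)

Lemma bitlen_ltn_exp a m : 0 < m -> a < 2 ^ m -> bitlen a <= m.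
Proof.
move=> m0 am; case: (posnP a) => [->|a0]; first by rewrite /bitlen trunc_log0.
by rewrite /bitlen -(ltn_exp2l _ _ (isT : 1 < 2)) (leq_ltn_trans (trunc_logP _ a0)).
Qed.

Lemma ltn_exp_bitlen a : a < 2 ^ bitlen a.
Proof. exact: trunc_log_ltn. Qed.

Lemma input_size_mem w i : nth 0 w i < 2 ^ (input_size w).+1.
Proof.
case: (ltnP i (size w)) => iw; last by rewrite nth_default // expn_gt0.
apply: (leq_trans (ltn_exp_bitlen _)); rewrite leq_exp2l //; apply: leqW.
by rewrite /input_size (big_nth 0) big_mkord (bigD1 (Ordinal iw)) //= leq_addr.
Qed.

Lemma size_le_input_size w : size w <= input_size w.
Proof.
by rewrite -sum1_size /input_size; apply: leq_sum.
Qed.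

(** This bounds binary lengths: stored values may be exponential in [N], but their lengths are not.
    The summand 6 absorbs the constants in [16 + 2 ^ N.+1]. *)
Definition value_bound (N : nat) : nat := N + growth main_loop N + 6.

(** The prologue evaluates expressions of sizes 1 and 2, which accounts for the factor
    [1 + 4 = 5]. *)
Definition run_time (N : nat) : nat :=
  time_bound main_loop N (value_bound N) + 5 * value_bound N + 2.

Lemma poly_bounded_run_time : poly_bounded run_time.
Proof.
have hv : poly_bounded value_bound.
  apply: poly_bounded_add (poly_bounded_const 6).
  exact: poly_bounded_add poly_bounded_id (poly_bounded_growth main_loop).
apply: poly_bounded_add (poly_bounded_const 2).
apply: poly_bounded_add (poly_bounded_time main_loop hv) _.
exact: poly_bounded_mul (poly_bounded_const 5) hv.
Qed.

Lemma approx_cmd_spec (I : instance) :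
  exists t s, [/\ exec approx_cmd (init_state (encode_instance I)) t s,
    t <= run_time (input_size (encode_instance I))
  & (exists S : solution (space I), feasible S) ->
    exists S : solution (space I),
    [/\ is_approximation 5%R S,
        points I = locations I -> is_approximation 4%R S
      & output s = encode_solution S]].
Proof.
set w := encode_instance I; set N := input_size w.
set s0 := init_state w.
have m0 : mem s0 0 = #|space I| by [].
pose s1 := set_reg 2 (size w) s0; pose s2 := set_reg 1 #|space I| s1.
have e2 : env I s2 by split.
(* Large enough for every input entry and for the input length, and at least 16 as the time bounds
   require. *)
pose V := 16 + 2 ^ N.+1.
have sN : size w <= N by apply: size_le_input_size.
have N2 : N < 2 ^ N.+1 by apply: leq_trans (ltn_expl N (isT : 1 < 2)) _; rewrite leq_exp2l.
have nV : #|space I| < 2 ^ N.+1 by rewrite -m0; apply: input_size_mem.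
have nN : #|space I| <= N.
  by apply: leq_trans sN; rewrite size_input; lia.
have b0 : bounded V s0.
  split=> i.
    have sV : size w <= V by rewrite /V; lia.
    by rewrite /= /update; case: ifP => // _; apply: sV.
  by apply: leq_trans (ltnW (input_size_mem w i)) _; rewrite leq_addl.
have b1 : bounded V s1 by apply: bounded_set_reg => //; rewrite /V; lia.
have b2 : bounded V s2 by apply: bounded_set_reg => //; rewrite /V; lia.
have V16 : 16 <= V by rewrite leq_addr.
set g := growth main_loop N.
have Vw : bitlen (V + g) <= value_bound N.
  apply: bitlen_ltn_exp; first by rewrite /value_bound addnS.
  rewrite /value_bound -/g (expnD 2 (N + g) 6) (expnD 2 N g); have := ltn_expl g (isT : 1 < 2).
  have : 0 < 2 ^ N by rewrite expn_gt0.
  rewrite /V expnS (_ : 2 ^ 6 = 64) //; set a := 2 ^ N; set b := 2 ^ g => a0 gb.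
  have b0' : 0 < b by lia.
  have := leq_pmulr a b0'; have := leq_pmull b a0; lia.
have Vw' : bitlen V <= value_bound N.
  apply: leq_trans Vw; rewrite /bitlen ltnS; apply: leq_trunc_log.
  by rewrite leq_addr.
have [t Et Tt] := exec_run wf_main_loop (nN : regs s2 1 <= N) V16 b2 (leqnn _) Vw.
exists ((eval_time s0 (Reg 0)).+1 + ((eval_time s1 (Mem (Const 0))).+1 + t)).
exists (run main_loop s2); split.
- apply: exec_Seq (exec_SetReg s0 2 (Reg 0)) _.
  exact: exec_Seq (exec_SetReg s1 1 (Mem (Const 0))) Et.
- have := eval_time_le (e := Reg 0) V16 b0 isT Vw'.
  have := eval_time_le (e := Mem (Const 0)) V16 b1 isT Vw'.
  rewrite /run_time [expr_size _]/= [expr_size (Reg 0)]/=; lia.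
- exact: main_loop_spec e2 _.
Qed.

Local Open Scope ring_scope.

Theorem corollary8 :
  poly_time_approximable private_k_center_with_outliers 4 /\
  poly_time_approximable private_k_supplier_with_outliers 5.
Proof.
have [p pP] := poly_bounded_run_time.
(* One program serves both problems: its output meets the factor 5 always and the factor 4 when
   [P = L]. *)
split; exists approx_cmd, p => I domI;
  have [t [s [Et Tt H]]] := approx_cmd_spec I; exists t, s;
  split=> //; try exact: leq_trans Tt (pP _).
- by move=> /H[S [_ H4 out]]; exists S => //; apply: H4.
- by move=> /H[S [H5 _ out]]; exists S.
Qed.
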